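(* Let $\alpha,\beta,\alpha_1,\beta_1,\delta\in\mathbb{R}$ with $\beta\neq 0$, $\beta\neq\beta_1$, and let $0<\mu\le 1$, $0\le\nu\le 1$. Consider the cobweb model with Hilfer fractional derivative in the supply function $$D(t)=\alpha+\beta p(t),\qquad S(t)=\alpha_1+\beta_1\bigl(p(t)+\delta\cdot D_{0+}^{\mu,\nu}p(t)\bigr),\qquad D(t)=S(t).$$ The unique solution of this cobweb model is given by $$p(t)=C\,t^{\gamma-1}E_{\mu,\gamma}(\varrho t^{\mu})-\frac{\eta}{\varrho}+\frac{\eta}{\varrho}E_{\mu}(\varrho t^{\mu}),$$ where $\varrho=\dfrac{\beta_1-\beta}{\delta\beta}$, $\eta=\dfrac{\alpha_1-\alpha}{\delta\beta}$ and $C\in\mathbb{R}$.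
   Context: Here $p(t)$ is the market price, $D(t)$ the demand and $S(t)$ the supply at time $t$. The parameter $\gamma$ is $\gamma=\mu+\nu-\mu\nu$. The Riemann-Liouville fractional integral of order $\sigma>0$ is $I_{0+}^{\sigma}g(t)=\frac{1}{\Gamma(\sigma)}\int_0^t(t-s)^{\sigma-1}g(s)\,ds$, and $I_{0+}^0$ is the identity. The Hilfer fractional derivative of order $\mu$ and type $0\le\nu\le1$ is $D_{0+}^{\mu,\nu}g(t)=I_{0+}^{\nu(1-\mu)}\,\frac{d}{dt}\,I_{0+}^{(1-\nu)(1-\mu)}g(t)$. The Mittag-Leffler functions are $E_{\mu,\gamma}(z)=\sum_{k=0}^{\infty}\frac{z^k}{\Gamma(\mu k+\gamma)}$ and $E_\mu(z)=E_{\mu,1}(z)$.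
   Formalization: The printed constants do not solve the printed model; the formal theorem uses ϱ=(β−β₁)/(δβ₁) and η=(α−α₁)/(δβ₁), and additionally assumes β₁≠0 and δ≠0. *)

(* Defs.v *)
From mathcomp Require Import all_boot all_order all_algebra.
From mathcomp Require Import all_classical all_reals all_analysis.

Set Implicit Arguments.
Unset Strict Implicit.
Unset Printing Implicit Defensive.

Import Order.TTheory GRing.Theory Num.Theory.
Import numFieldNormedType.Exports.
Local Open Scope classical_set_scope.
Local Open Scope ring_scope.

Definition Gamma (R : realType) (x : R) : R :=
  \int[lebesgue_measure]_(t in `]0, +oo[) (t `^ (x - 1) * expR (- t)).

Definition mittag_leffler (R : realType) (mu gam z : R) : R :=
  limn (series (fun k : nat => z ^+ k / Gamma (mu * k%:R + gam))).

Definition RL_kernel (R : realType) (sigma : R) (g : R -> R) (t s : R) : R :=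
  (t - s) `^ (sigma - 1) * g s.

(* Meant for sigma >= 0 and t > 0; only the values of g on (0, +oo) matter. *)
Definition RL_integral (R : realType) (sigma : R) (g : R -> R) (t : R) : R :=
  if sigma == 0 then g t
  else (Gamma sigma)^-1 *
       \int[lebesgue_measure]_(s in `]0, t[) RL_kernel sigma g t s.

(* [Rintegral] is total, so the convergence of the integrals defining
   [RL_integral sigma g] on (0, +oo) is a separate condition. *)
Definition RL_integrable (R : realType) (sigma : R) (g : R -> R) : Prop :=
  sigma != 0 -> forall t : R, 0 < t ->
    lebesgue_measure.-integrable `]0, t[ (EFin \o RL_kernel sigma g t).

Definition hilfer (R : realType) (mu nu : R) (g : R -> R) : R -> R :=
  RL_integral (nu * (1 - mu))
    (derive1 (RL_integral ((1 - nu) * (1 - mu)) g)).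

(* The three successive operations in [hilfer mu nu g] make sense at every
   point of (0, +oo). *)
Definition hilfer_derivable (R : realType) (mu nu : R) (g : R -> R) : Prop :=
  [/\ RL_integrable ((1 - nu) * (1 - mu)) g,
      forall t : R, 0 < t ->
        derivable (RL_integral ((1 - nu) * (1 - mu)) g) t 1
    & RL_integrable (nu * (1 - mu))
        (derive1 (RL_integral ((1 - nu) * (1 - mu)) g))].

Definition demand (R : realType) (alpha beta : R) (p : R -> R) (t : R) : R :=
  alpha + beta * p t.

Definition supply (R : realType) (alpha1 beta1 delta mu nu : R)
    (p : R -> R) (t : R) : R :=
  alpha1 + beta1 * (p t + delta * hilfer mu nu p t).

(* Time ranges over t > 0: prices may be singular at 0, like t^(gamma-1). *)
Definition cobweb_solution (R : realType)
    (alpha beta alpha1 beta1 delta mu nu : R) (p : R -> R) : Prop :=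
  hilfer_derivable mu nu p /\
  forall t : R, 0 < t ->
    demand alpha beta p t = supply alpha1 beta1 delta mu nu p t.

(* Main.v *)
Require Import Defs.
From HB Require Import structures.
From mathcomp Require Import all_boot all_order all_algebra.
From mathcomp Require Import all_classical all_reals all_analysis.
From mathcomp Require Import measurable_realfun ring lra.

Set Implicit Arguments.
Unset Strict Implicit.
Unset Printing Implicit Defensive.

Import Order.TTheory GRing.Theory Num.Theory.
Import numFieldNormedType.Exports.
Local Open Scope classical_set_scope.
Local Open Scope ring_scope.

(** Put [a = (1 - nu) * (1 - mu)] and [b = nu * (1 - mu)], so that
    [a + b = 1 - mu] and [gam = 1 - a].  Solving the market equation for the
    Hilfer derivative turns the model into the linear equation
    [I^b (I^a p)' = rho * p + eta] ([cobweb_solutionE]).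

    Let [k_s t = t ^ (s - 1) / Gamma s] ([rl_ker]), so that [I^s] is the
    convolution with [k_s].  The Beta integral gives the convolution identity
    of [k_s] and [k_r] with result [k_(s + r)] ([conv_rl_ker]), whence the
    semigroup law [I^s I^r = I^(s + r)] ([RL_semigroup]).  The functions
    [e_th t = t ^ (th - 1) * E_(mu, th) (rho * t ^ mu)] ([ml_ker]) are the sums
    of the series [rho ^ k * k_(mu * k + th)], so [I^s e_th = e_(th + s)]
    ([RL_ml_ker]), [e_(th + 1)' = e_th] ([derive1_ml_ker]) and
    [e_th = k_th + rho * e_(th + mu)] ([ml_ker_recl]).  The announced formula is
    [p = C * e_gam + eta * e_(mu + 1)] ([price_formulaE]), and it solves the
    equation because all operations in it shift indices: [I^a p] is
    [C * e_1 + eta * e_(mu + a + 1)], its derivative is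
    [C * rho * e_mu + eta * e_(mu + a)], and [I^b] of the latter is
    [C * rho * e_gam + eta * e_1 = rho * p + eta] ([hilfer_ml_ker]).

    Conversely let [p] be a solution and [f = I^a p].  The derivative [f'] exists
    everywhere on the half line and is integrable near [0], but nothing makes it
    continuous; that [f = c + I^1 f'] therefore rests on the fundamental theorem
    of calculus for an everywhere existing Lebesgue integrable derivative
    ([integral_derive1]), which is derived from the Vitali-Caratheodory theorem.
    By the semigroup law [I^1 f' = I^(1 - b) (I^b f') = I^(mu + a) (rho * p + eta)],
    so [f] solves the Volterra equation
    [f = c + rho * I^mu f + eta * k_(mu + a + 1)] ([hilfer_volterra]).  That
    equation has one solution for each [c] ([volterra_uniqueness]), namely
    [I^a] of the explicit [p] with [C = c].  The two functions [f] agree, hence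
    so do their derivatives, and [rho * p = I^b f' - eta] determines [p] as
    [rho] is nonzero ([hilfer_unique]). *)

(** * Affine change of variables and the Gamma function *)

(** The measure [`|a| * lambda (phi^-1 A)], for [phi x = a * x + b], agrees with
    the Lebesgue measure on half-open intervals, hence everywhere. *)
Lemma ge0_integral_affine (R : realType) (a b : R) (f : R -> \bar R) :
  a != 0 -> measurable_fun [set: R] f -> (forall x, (0 <= f x)%E) ->
  (\int[lebesgue_measure]_x f x =
   `|a|%:E * \int[lebesgue_measure]_x f (a * x + b)%R)%E.
Proof.
move=> a0 mf f0.
pose phi := (fun x : R => a * x + b) : measurableTypeR R -> measurableTypeR R.
have mphi : measurable_fun [set: measurableTypeR R] phi.
  by apply: measurable_funD => //; exact: measurable_funM.
have na0 : 0 <= `|a| by [].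
pose push : {measure set (measurableTypeR R) -> \bar R} :=
  measure_function_pushforward__canonical__measure_function_Measure
    lebesgue_measure mphi.
pose nu : {measure set (measurableTypeR R) -> \bar R} :=
  mscale (NngNum na0) push.
have nuS A : nu A = (`|a|%:E * lebesgue_measure (phi @^-1` A))%E by [].
have nuE A : measurable A -> lebesgue_measure A = nu A.
  apply: lebesgue_measure_unique => _ [[u v]] _ <-.
  rewrite nuS.
  have [apos|aneg] := ltP 0 a.
    have -> : phi @^-1` `]u, v]%classic = `](u - b) / a, (v - b) / a]%classic.
      apply/seteqP; split => x /=; rewrite !in_itv /= /phi ltr_pdivrMr// ler_pdivlMr//;
        by rewrite ltrBlDr lerBrDr (mulrC a).
    rewrite !lebesgue_measure_itv /= !lte_fin ltr_pM2r ?invr_gt0// ltrD2r.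
    case: ifPn => // _; last by rewrite mule0.
    rewrite -!EFinB -EFinM gtr0_norm//; congr EFin; field; exact: lt0r_neq0.
  have an : a < 0 by rewrite lt_neqAle a0.
  have -> : phi @^-1` `]u, v]%classic = `[(v - b) / a, (u - b) / a[%classic.
    apply/seteqP; split => x /=; rewrite !in_itv /= /phi ler_ndivrMr// ltr_ndivlMr//;
      by rewrite ltrBlDr lerBrDr (mulrC a) andbC.
  rewrite !lebesgue_measure_itv /= !lte_fin ltr_nM2r ?invr_lt0// ltrD2r.
  case: ifPn => // _; last by rewrite mule0.
  rewrite -!EFinB -EFinM ltr0_norm//; congr EFin; field; exact: ltr0_neq0.
transitivity (\int[nu]_x f x)%E.
  apply: eq_measure_integral => A mA _; exact: nuE.
rewrite ge0_integral_mscale//= ge0_integral_pushforward//.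
Qed.

(** The extension by zero makes integrals over [(0, t)] convolutions on the
    whole line, without moving boundaries. *)
Definition pospow (R : realType) (s x : R) : R :=
  if 0 < x then x `^ (s - 1) else 0.

Lemma pospow_ge0 (R : realType) (s x : R) : 0 <= pospow s x.
Proof. by rewrite /pospow; case: ifP => // _; exact: powR_ge0. Qed.

Lemma measurable_pospow (R : realType) (s : R) (D : set R) :
  measurable_fun D (pospow s).
Proof.
rewrite /pospow; apply: measurable_funTS; apply: measurable_fun_ifT => //.
exact: measurable_fun_ltr.
Qed.

(** Monotone limit of the integrals over [[1/n, 1]], which are
    [(1 - (1/n) ^ s) / s]. *)
Lemma integral_pospow01 (R : realType) (s : R) : 0 < s ->
  (\int[lebesgue_measure]_(x in `]0%R, 1%R]) (pospow s x)%:E <= (s^-1)%:E)%E.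
Proof.
move=> s0.
pose F (n : nat) := `[n.+1%:R^-1 : R, 1]%classic.
have FE : \bigcup_n F n = `]0, 1]%classic.
  apply/seteqP; split => x /=.
    move=> [n _]; rewrite /F /= !in_itv /= => /andP[nx ->]; rewrite andbT.
    by apply: lt_le_trans nx; rewrite invr_gt0.
  rewrite in_itv /= => /andP[x0 x1]; exists (Num.truncn x^-1) => //.
  rewrite /F /= in_itv /= x1 andbT invf_ple ?posrE//.
  by apply/ltW; rewrite truncnS_gt.
have Fn n : (\int[lebesgue_measure]_(x in F n) (pospow s x)%:E <= (s^-1)%:E)%E.
  case: n => [|n].
    by rewrite /F invr1 set_itv1 integral_set1 lee_fin invr_ge0 ltW.
  have n0 : 0 < (n.+2%:R : R)^-1 by rewrite invr_gt0.
  have n1 : (n.+2%:R : R)^-1 < 1 by rewrite invf_lt1// ltr1n.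
  have dF (x : R) : 0 < x -> derivable (fun y => s^-1 * y `^ s) x 1.
    by move=> x0; apply: derivableM => //; apply: derivable_powR; rewrite in_itv/= x0.
  rewrite (eq_integral (fun x : measurableTypeR R => ((x : R) `^ (s - 1))%:E)); last first.
    move=> x; rewrite inE /F /= in_itv /= => /andP[nx _].
    by rewrite /pospow (lt_le_trans n0 nx).
  rewrite (@continuous_FTC2 _ _ (fun x => s^-1 * x `^ s))//.
  - rewrite -EFinB lee_fin powR1 mulr1 lerBlDr lerDl.
    by rewrite mulr_ge0 ?invr_ge0 ?powR_ge0// ltW.
  - apply: derivable_within_continuous => x.
    rewrite in_itv /= => /andP[nx _]; apply: derivable_powR.
    by rewrite in_itv /= (lt_le_trans n0 nx).
  - have cF (x : R) : 0 < x -> {for x, continuous (fun y => s^-1 * y `^ s)}.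
      by move=> x0; apply/differentiable_continuous/derivable1_diffP/dF.
    split.
    + by move=> x; rewrite in_itv /= => /andP[nx _]; apply: dF; exact: lt_trans nx.
    + exact/cvg_at_right_filter/cF.
    + exact/cvg_at_left_filter/cF.
  - move=> x; rewrite in_itv /= => /andP[nx _].
    have x0 : 0 < x by exact: lt_trans nx.
    rewrite derive1E deriveM//; last first.
      by apply: derivable_powR; rewrite in_itv/= x0.
    rewrite derive_cst scaler0 addr0 -derive1E powR_derive1 ?in_itv/= ?x0//.
    by rewrite /GRing.scale /= mulrA mulVf ?gt_eqF// mul1r.
rewrite -FE; apply: (@cvge_le nat \oo _ R
  (fun n => \int[lebesgue_measure]_(x in F n) (pospow s x)%:E)%E).
  by apply: nearW => n; exact: Fn.
apply: ge0_nondecreasing_set_cvg_integral => //.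
- apply/nondecreasing_seqP => n; rewrite subsetEset => x; rewrite /F /= !in_itv /=.
  move=> /andP[nx ->]; rewrite andbT; apply: le_trans nx.
  by rewrite lef_pV2 ?posrE// ler_nat.
- by move=> n; exact: measurable_itv.
- by move=> n; apply/measurable_EFinP; exact: measurable_pospow.
- by move=> n x _; rewrite lee_fin pospow_ge0.
Qed.

Definition gamma_density (R : realType) (s x : R) : R :=
  pospow s x * expR (- x).

Lemma gamma_density_ge0 (R : realType) (s x : R) : 0 <= gamma_density s x.
Proof. by rewrite mulr_ge0 ?pospow_ge0 ?expR_ge0. Qed.

Lemma measurable_gamma_density (R : realType) (s : R) (D : set R) :
  measurable_fun D (gamma_density s).
Proof.
apply: measurable_funM; first exact: measurable_pospow.
by apply: measurable_funTS; apply: measurableT_comp => //; exact: measurable_expR.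
Qed.

(** Raise [1 + y <= expR y] at [y = x / (2 * s)] to the power [s]. *)
Lemma powR_le_expR_half (R : realType) (s : R) : 0 < s ->
  exists2 C : R, 0 <= C & forall x, 0 < x -> x `^ s <= C * expR (x / 2).
Proof.
move=> s0; exists ((2 * s) `^ s); first exact: powR_ge0.
move=> x x0; have s2 : 0 < 2 * s by rewrite mulr_gt0.
have -> : expR (x / 2) = expR (x / (2 * s)) `^ s.
  by rewrite -expRM; congr expR; field; rewrite gt_eqF.
rewrite -powRM ?expR_ge0 ?(ltW s2)//; apply: ge0_ler_powR.
- exact: ltW.
- by rewrite nnegrE ltW.
- by rewrite nnegrE mulr_ge0 ?expR_ge0// ltW.
- rewrite -ler_pdivrMl// mulrC; apply: le_trans (expR_ge1Dx _).
  by rewrite lerDr.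
Qed.

(** On [(0, 1]] the density is below [pospow s]; beyond [1] it is below a
    multiple of the exponential density of rate 1/2. *)
Lemma integral_gamma_density_lty (R : realType) (s : R) : 0 < s ->
  (\int[lebesgue_measure]_x (gamma_density s x)%:E < +oo)%E.
Proof.
move=> s0.
have [C C0 HC] : exists2 C : R, 0 <= C &
    forall x, 1 <= x -> gamma_density s x <= C * exponential_pdf 2^-1 x.
  have [C C0 HC] := powR_le_expR_half s0.
  exists (C * 2); first by rewrite mulr_ge0.
  move=> x x1; have x0 : 0 < x by exact: lt_le_trans x1.
  rewrite exponential_pdfE ?(ltW x0)// /gamma_density /pospow x0.
  rewrite [leRHS](_ : _ = C * expR (- 2^-1 * x)); last first.
    by rewrite -mulrA [2 * _]mulrA mulfV// mul1r.
  apply: (@le_trans _ _ (x `^ s * expR (- x))).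
    by rewrite ler_wpM2r ?expR_ge0// ler_powR// lerBlDr lerDl.
  apply: (@le_trans _ _ (C * expR (x / 2) * expR (- x))).
    by rewrite ler_wpM2r ?expR_ge0// HC.
  by rewrite -mulrA ler_wpM2l// -expRD ler_expR; lra.
pose g := fun x : measurableTypeR R => ((pospow s \_ `]0%R, 1%R]) x)%:E.
pose h := fun x : measurableTypeR R => (C * exponential_pdf 2^-1 x)%:E.
have mg : measurable_fun [set: measurableTypeR R] g.
  apply/measurable_EFinP; apply/measurable_restrict => //.
  exact: measurable_pospow.
have mh : measurable_fun [set: measurableTypeR R] h.
  apply/measurable_EFinP; apply: measurable_funM => //.
  exact: measurable_exponential_pdf.
have g0 x : (0 <= g x)%E.
  by rewrite lee_fin patchE; case: ifP => // _; exact: pospow_ge0.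
have h0 x : (0 <= h x)%E.
  by rewrite lee_fin mulr_ge0// exponential_pdf_ge0.
apply: (@le_lt_trans _ _ (\int[lebesgue_measure]_x (g x + h x))%E).
  apply: ge0_le_integral => //.
  - by move=> x _; rewrite lee_fin gamma_density_ge0.
  - by apply/measurable_EFinP; exact: measurable_gamma_density.
  - by apply: emeasurable_funD.
  - move=> x _; have [x0|x0] := leP x 0.
      by rewrite {1}/gamma_density {1}/pospow ltNge x0 /= mul0r adde_ge0.
    rewrite lee_fin patchE.
    case: ifPn => [_|].
      rewrite -[leLHS]addr0 lerD//; last by have := h0 x; rewrite lee_fin.
      by rewrite ler_piMr ?pospow_ge0// -expR0 ler_expR oppr_le0 ltW.
    rewrite notin_setE /= in_itv /= x0 /= => /negP; rewrite -ltNge => x1.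
    by rewrite add0r HC// ltW.
rewrite ge0_integralD//.
have -> : (\int[lebesgue_measure]_x h x = C%:E)%E.
  rewrite /h; under eq_integral do rewrite EFinM.
  rewrite ge0_integralZl//.
  - by rewrite integral_exponential_pdf// mule1.
  - by apply/measurable_EFinP; exact: measurable_exponential_pdf.
  - by move=> x _; rewrite lee_fin exponential_pdf_ge0.
apply: lte_add_pinfty; last exact: ltry.
apply: (@le_lt_trans _ _ (s^-1)%:E); last exact: ltry.
apply: le_trans (integral_pospow01 s0).
by rewrite [leRHS]integral_mkcond /g /=; under [in leRHS]eq_integral do rewrite restrict_EFin.
Qed.

Lemma Gamma_EFin (R : realType) (s : R) : 0 < s ->
  ((Gamma s)%:E = \int[lebesgue_measure]_x (gamma_density s x)%:E)%E.
Proof.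
move=> s0; rewrite /Gamma Rintegral_mkcond /Rintegral.
rewrite (_ : (fun x => _) = (fun x : measurableTypeR R => (gamma_density s x)%:E)).
  rewrite fineK// ge0_fin_numE ?integral_gamma_density_lty//.
  by apply: integral_ge0 => x _; rewrite lee_fin gamma_density_ge0.
apply/funext => x; rewrite patchE /gamma_density /pospow.
have [x0|x0] := ltP 0 x; first by rewrite ifT// inE /= in_itv /= x0.
by rewrite ifF ?mul0r//; apply/negbTE; rewrite notin_setE /= in_itv /= andbT ltNge x0.
Qed.

(** The integrand is bounded below on [[M, M + 1]].  At [M = 1] this gives
    positivity; with [M] large and fixed it shows that [Gamma s] grows faster
    than any exponential in [s]. *)
Lemma Gamma_ge (R : realType) (s M : R) : 0 < s -> 0 < M ->
  M `^ s * (expR (- (M + 1)) / (M + 1)) <= Gamma s.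
Proof.
move=> s0 M0; rewrite -lee_fin Gamma_EFin//.
set K := M `^ s * _.
have M1 : 0 < M + 1 by rewrite addr_gt0.
have -> : K%:E = (\int[lebesgue_measure]_(x in `[M, (M + 1)%R]) K%:E)%E.
  rewrite integral_cst//= lebesgue_measure_itv /= lte_fin ltrDl ltr01.
  by rewrite -EFinB addrAC subrr add0r mule1.
rewrite integral_mkcond; apply: ge0_le_integral => //.
- move=> x _; apply: erestrict_ge0 => y _.
  by rewrite lee_fin /K mulr_ge0 ?powR_ge0// divr_ge0 ?expR_ge0// ltW.
- apply/measurable_restrict => //; exact: measurable_cst.
- by apply/measurable_EFinP; exact: measurable_gamma_density.
- move=> x _; rewrite patchE; case: ifPn => [|_]; last by rewrite lee_fin gamma_density_ge0.
  rewrite inE /= in_itv /= => /andP[Mx xM].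
  have x0 : 0 < x by exact: lt_le_trans Mx.
  have xE : x `^ (s - 1) = x `^ s / x.
    by rewrite powRB ?powRr1 ?(ltW x0)// (gt_eqF x0) implybT.
  rewrite lee_fin /K /gamma_density /pospow x0 xE.
  rewrite mulrA [leRHS]mulrAC ler_pM ?invr_ge0 ?mulr_ge0 ?powR_ge0 ?expR_ge0 ?(ltW M1)//.
    rewrite ler_pM ?powR_ge0 ?expR_ge0//.
      by rewrite ge0_ler_powR ?nnegrE ?(ltW s0) ?(ltW M0) ?(ltW x0).
    by rewrite ler_expR lerN2.
  by rewrite lef_pV2 ?posrE.
Qed.

Lemma Gamma_gt0 (R : realType) (s : R) : 0 < s -> 0 < Gamma s.
Proof.
move=> s0; apply: lt_le_trans (Gamma_ge s0 ltr01).
by rewrite mulr_gt0 ?powR_gt0// divr_gt0 ?expR_gt0.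
Qed.

Lemma Gamma1 (R : realType) : Gamma (1 : R) = 1.
Proof.
apply: EFin_inj; rewrite Gamma_EFin// -(integral_exponential_pdf (@ltr01 R)).
apply: ae_eq_integral => //.
- by apply/measurable_EFinP; exact: measurable_gamma_density.
- by apply/measurable_EFinP; apply: measurable_funTS; exact: measurable_exponential_pdf.
exists [set 0]; split => //; first exact: lebesgue_measure_set1.
move=> x /=; apply: contra_notP => /eqP x0 _; congr EFin.
rewrite /gamma_density /pospow subrr powRr0.
have [xp|xn] := ltP 0 x.
  by rewrite exponential_pdfE ?(ltW xp)// mulN1r.
by rewrite mul0r lt0_exponential_pdf// lt_neqAle x0.
Qed.

(** * The Beta integral and the convolution of power kernels *)

Lemma pospow_scale (R : realType) (s t x : R) : 0 < t ->
  pospow s (t * x) = t `^ (s - 1) * pospow s x.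
Proof.
move=> t0; rewrite /pospow pmulr_rgt0//; case: ifPn => [x0|_]; last by rewrite mulr0.
by rewrite powRM// ltW.
Qed.

(** The substitution [x = t * y]; the integral on the right is the Beta
    function at [s] and [r]. *)
Lemma conv_pospow_scale (R : realType) (s r t : R) : 0 < t ->
  (\int[lebesgue_measure]_x (pospow s (t - x) * pospow r x)%:E =
   (t `^ (s + r - 1))%:E *
   \int[lebesgue_measure]_x (pospow s (1 - x) * pospow r x)%R%:E)%E.
Proof.
move=> t0.
have mf u : measurable_fun [set: R] (fun x => (pospow s (u - x) * pospow r x)%:E).
  apply/measurable_EFinP; apply: measurable_funM; last exact: measurable_pospow.
  apply: (measurableT_comp (measurable_pospow s (D := setT))).
  exact: measurable_funB.
rewrite (@ge0_integral_affine _ t 0 _ (lt0r_neq0 t0) (mf t)); last first.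
  by move=> x; rewrite lee_fin mulr_ge0// pospow_ge0.
rewrite (gtr0_norm t0).
rewrite (_ : (fun x => _) = (fun x : measurableTypeR R => (t `^ (s - 1) * t `^ (r - 1))%:E *
    (pospow s (1 - x) * pospow r x)%R%:E)%E); last first.
  apply/funext => x; rewrite addr0 -EFinM; congr EFin.
  rewrite (_ : t - t * x = t * (1 - x)); last by rewrite mulrBr mulr1.
  by rewrite !pospow_scale// mulrACA.
rewrite ge0_integralZl//; last 3 first.
- exact: mf.
- by move=> x _; rewrite lee_fin mulr_ge0// pospow_ge0.
- by rewrite lee_fin mulr_ge0// powR_ge0.
rewrite muleA -EFinM; congr (_%:E * _)%E.
rewrite -powRD; last by rewrite (gt_eqF t0) implybT.
rewrite -[X in X * _](powRr1 (ltW t0)) -powRD; last by rewrite (gt_eqF t0) implybT.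
congr powR; ring.
Qed.

Lemma conv_pospow_le0 (R : realType) (s r t : R) : t <= 0 ->
  (\int[lebesgue_measure]_x (pospow s (t - x) * pospow r x)%:E = 0)%E.
Proof.
move=> t0; apply: integral0_eq => x _; congr EFin; rewrite /pospow.
have [x0|x0] := ltP 0 x; last by rewrite mulr0.
by rewrite subr_gt0 ltNge (le_trans t0 (ltW x0)) mul0r.
Qed.

(** Tonelli for the density of the sum of two independent Gamma variables:
    [expR (- (x - y)) * expR (- y) = expR (- x)] leaves the integrals of
    [conv_pospow_scale], whose dependence on [x] is the power
    [x ^ (s + r - 1)]. *)
Lemma Gamma_mul (R : realType) (s r : R) : 0 < s -> 0 < r ->
  ((Gamma s * Gamma r)%:E = (Gamma (s + r))%:E *
   \int[lebesgue_measure]_x (pospow s (1 - x) * pospow r x)%R%:E)%E.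
Proof.
move=> s0 r0.
pose f (z : measurableTypeR R * measurableTypeR R) : \bar R :=
  (gamma_density s (z.1 - z.2) * gamma_density r z.2)%:E.
have f0 z : (0 <= f z)%E by rewrite lee_fin mulr_ge0// gamma_density_ge0.
have mf : measurable_fun setT f.
  apply/measurable_EFinP; apply: measurable_funM.
    apply: (measurableT_comp (measurable_gamma_density s (D := setT))).
    by apply: measurable_funB; [exact: measurable_fst|exact: measurable_snd].
  by apply: (measurableT_comp (measurable_gamma_density r (D := setT))); exact: measurable_snd.
have := @fubini_tonelli _ _ _ _ R lebesgue_measure lebesgue_measure f mf f0.
have -> : (\int[lebesgue_measure]_y \int[lebesgue_measure]_x f (x, y) =
          (Gamma s * Gamma r)%:E)%E.
  rewrite (_ : (fun y => _) = (fun y : measurableTypeR R =>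
     (Gamma s)%:E * (gamma_density r y)%:E)%E).
    rewrite ge0_integralZl//.
    - by rewrite -Gamma_EFin// -EFinM.
    - by apply/measurable_EFinP; exact: measurable_gamma_density.
    - by move=> x _; rewrite lee_fin gamma_density_ge0.
    - by rewrite lee_fin ltW// Gamma_gt0.
  apply/funext => y; rewrite Gamma_EFin//.
  rewrite [in RHS](@ge0_integral_affine _ 1 (- y))//; last 2 first.
  - by apply/measurable_EFinP; exact: measurable_gamma_density.
  - by move=> x; rewrite lee_fin gamma_density_ge0.
  rewrite normr1 mul1e muleC -ge0_integralZl; last 4 first.
  - exact: measurableT.
  - apply/measurable_EFinP.
    apply: (measurableT_comp (measurable_gamma_density s (D := setT))).
    by apply: measurable_funD => //; exact: measurable_funM.
  - by move=> x _; rewrite lee_fin gamma_density_ge0.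
  - by rewrite lee_fin gamma_density_ge0.
  by apply: eq_integral => x _; rewrite /f /= mul1r mulrC EFinM.
move=> <-.
rewrite Gamma_EFin ?addr_gt0// muleC -ge0_integralZl//; last 3 first.
- by apply/measurable_EFinP; exact: measurable_gamma_density.
- by move=> x _; rewrite lee_fin gamma_density_ge0.
- by apply: integral_ge0 => x _; rewrite lee_fin mulr_ge0// pospow_ge0.
apply: eq_integral => x _.
have -> : (\int[lebesgue_measure]_y f (x, y) = (expR (- x))%:E *
    \int[lebesgue_measure]_y (pospow s (x - y) * pospow r y)%R%:E)%E.
  rewrite -ge0_integralZl//; last 2 first.
  - apply/measurable_EFinP; apply: measurable_funM; last exact: measurable_pospow.
    apply: (measurableT_comp (measurable_pospow s (D := setT))).
    exact: measurable_funB.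
  - by move=> y _; rewrite lee_fin mulr_ge0// pospow_ge0.
  apply: eq_integral => y _; rewrite /f /= /gamma_density -EFinM; congr EFin.
  rewrite mulrACA mulrC -expRD; congr (expR _ * _); ring.
rewrite [RHS]muleC.
have [x0|x0] := ltP 0 x.
  rewrite conv_pospow_scale// muleA -EFinM; congr (_ * _)%E; congr EFin.
  by rewrite /gamma_density /pospow x0 mulrC.
by rewrite conv_pospow_le0// /gamma_density /pospow ltNge x0 mul0r mule0 mul0e.
Qed.

Lemma conv_pospow (R : realType) (s r t : R) : 0 < s -> 0 < r ->
  (\int[lebesgue_measure]_x (pospow s (t - x) * pospow r x)%:E =
   (pospow (s + r) t * (Gamma s * Gamma r / Gamma (s + r)))%:E)%E.
Proof.
move=> s0 r0; have sr0 : 0 < s + r by exact: addr_gt0.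
have G0 := Gamma_gt0 sr0.
have [t0|t0] := ltP 0 t; last first.
  by rewrite conv_pospow_le0// /pospow ltNge t0 mul0r.
rewrite conv_pospow_scale// /pospow t0 EFinM; congr (_ * _)%E.
rewrite EFinM Gamma_mul// muleAC -EFinM mulfV ?gt_eqF// mul1e.
by [].
Qed.

(** The kernel of the fractional integral of order [s]: [t ^ (s - 1) / Gamma s]
    extended by zero, so that [RL_integral s g] is a convolution on the line. *)
HB.lock Definition rl_ker (R : realType) (s x : R) : R := pospow s x / Gamma s.

Lemma rl_kerE (R : realType) (s x : R) : rl_ker s x = pospow s x / Gamma s.
Proof. by rewrite rl_ker.unlock. Qed.

Lemma rl_ker_ge0 (R : realType) (s x : R) : 0 < s -> 0 <= rl_ker s x.
Proof. by move=> s0; rewrite rl_kerE divr_ge0 ?pospow_ge0// ltW// Gamma_gt0. Qed.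

Lemma measurable_rl_ker (R : realType) (s : R) (D : set R) :
  measurable_fun D (rl_ker s).
Proof.
rewrite rl_ker.unlock; apply: measurable_funM => //; exact: measurable_pospow.
Qed.

(** The normalisation by [Gamma] absorbs the Beta factor, so that the kernels
    form a convolution semigroup. *)
Lemma conv_rl_ker (R : realType) (s r t : R) : 0 < s -> 0 < r ->
  (\int[lebesgue_measure]_x (rl_ker s (t - x) * rl_ker r x)%:E =
   (rl_ker (s + r) t)%:E)%E.
Proof.
move=> s0 r0; have Gs := Gamma_gt0 s0; have Gr := Gamma_gt0 r0.
rewrite (eq_integral (fun x : measurableTypeR R => ((Gamma s * Gamma r)^-1)%:E *
   (pospow s (t - x) * pospow r x)%R%:E)%E); last first.
  by move=> x _; rewrite -EFinM !rl_kerE; congr EFin; rewrite mulrACA mulrC invfM.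
rewrite ge0_integralZl//; last 3 first.
- apply/measurable_EFinP; apply: measurable_funM; last exact: measurable_pospow.
  apply: (measurableT_comp (measurable_pospow s (D := setT))).
  exact: measurable_funB.
- by move=> y _; rewrite lee_fin mulr_ge0// pospow_ge0.
- by rewrite lee_fin invr_ge0 mulr_ge0 ?ltW.
rewrite conv_pospow// -EFinM; congr EFin; rewrite !rl_kerE.
have := Gamma_gt0 (addr_gt0 s0 r0).
move: (Gamma s) (Gamma r) (Gamma (s + r)) Gs Gr => A B C A0 B0 C0.
by field; rewrite (gt_eqF A0) (gt_eqF B0) (gt_eqF C0).
Qed.

(** * The fundamental theorem of calculus for an integrable derivative *)

(** Cut [[a, b]] into the level sets [A m] on which [g] lies between [z m * e]
    and [(z m + 1) * e].  Cover each by an open [U m] and add a weight [w m] on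
    [U m `\` A m], large enough to dominate the oscillation of [g] there.  Near
    a point [x] of [A m] the sum of [g + 2 * e] and of the weights stays above
    [g x + e]: on [A m] since [g] varies by less than [e], elsewhere thanks to
    the weight.  By absolute
    continuity of the integral of [w m], [U m] can be taken so close to [A m]
    that the weights cost at most [e] in total. *)
Lemma vitali_caratheodory (R : realType) (a b e : R) (g : R -> R) :
  0 < e -> lebesgue_measure.-integrable `[a, b] (EFin \o g) ->
  exists Phi : R -> \bar R,
  [/\ lebesgue_measure.-integrable `[a, b] Phi,
      forall x, x \in `[a, b] ->
        \forall s \near x, s \in `[a, b] -> ((g x + e)%:E <= Phi s)%E &
      (\int[lebesgue_measure]_(s in `[a, b]) Phi s <=
       \int[lebesgue_measure]_(s in `[a, b]) (g s)%:E +
       (2 * e * `|b - a| + e)%:E)%E].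
Proof.
move=> e0 ig; have mg : measurable_fun `[a, b] g.
  by apply/measurable_EFinP; exact: measurable_int ig.
have mD : measurable (`[a, b]%classic : set R) by exact: measurable_itv.
have muD : (lebesgue_measure (`[a, b]%classic : set R) <= `|b - a|%:E)%E.
  rewrite lebesgue_measure_itv /= lte_fin; case: ifPn => // _.
  by rewrite -EFinB lee_fin ler_norm.
(* An enumeration of the integers. *)
pose z (m : nat) : R := (odflt 0 (unpickle m : option int))%:~R.
(* [g s + w m s] is at least [(`|z m| + 2) * e], hence above [g x + e] for [x] in [A m]. *)
pose w m (s : R) : R := `|g s| + (`|z m| + 2) * e.
have w0 m s : 0 <= w m s by rewrite addr_ge0// mulr_ge0 ?addr_ge0// ltW.
pose A m := `[a, b]%classic `&` g @^-1` `[z m * e, (z m + 1) * e[%classic.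
have mA m : measurable (A m) by apply: mg => //; exact: measurable_itv.
have iw m : lebesgue_measure.-integrable setT (EFin \o (w m \_ `[a, b])).
  rewrite -restrict_EFin; apply/integrable_restrict => //; rewrite setTI.
  rewrite (_ : EFin \o w m = (EFin \o (Num.norm \o g)) \+
     (EFin \o cst ((`|z m| + 2) * e)%R))%E; last by apply/funext => s.
  apply: integrableD => //; first exact: integrable_norm.
  apply: measurable_bounded_integrable => //.
  - by apply: le_lt_trans muD _; exact: ltry.
  - exact: bounded_cst.
have em m : 0 < e / (2 ^ m.+1)%:R by rewrite divr_gt0// ltr0n expn_gt0.
have [U HU] : {U : nat -> set R & forall m, [/\ open (U m), A m `<=` U m &
   (\int[lebesgue_measure]_(s in U m `\` A m) ((w m \_ `[a, b]) s)%:E <=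
     (e / (2 ^ m.+1)%:R)%:E)%E]}.
  apply: (@choice _ _ (fun m U => [/\ open U, A m `<=` U &
   (\int[lebesgue_measure]_(s in U `\` A m) ((w m \_ `[a, b]) s)%:E <=
     (e / (2 ^ m.+1)%:R)%:E)%E])) => m.
  have [d [d0 Hd]] := integral_normr_continuous (iw m) (em m).
  have [|U [oU AU mUA]] := lebesgue_regularity_outer (mA m) _ d0.
    apply: (@le_lt_trans _ _ (lebesgue_measure (`[a, b]%classic : set R))).
      by apply: le_measure; [by apply: mem_set; exact: mA|exact/mem_set|exact: subIsetl].
    by apply: le_lt_trans muD _; exact: ltry.
  exists U; split => //.
  have mUA' : measurable (U `\` A m).
    by apply: measurableD => //; exact: open_measurable.
  have := Hd _ mUA' mUA; rewrite -lte_fin => /ltW; apply: le_trans.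
  rewrite /Rintegral fineK.
    apply: ge0_le_integral => //.
    + by move=> s _; rewrite lee_fin patchE; case: ifP.
    + apply: measurable_funS (measurable_int _ (iw m)) => //.
    + apply/measurable_EFinP; apply: measurableT_comp => //; apply/measurable_EFinP.
      by apply: measurable_funS (measurable_int _ (iw m)) => //.
    + by move=> s _; rewrite lee_fin ler_norm.
  apply: integrable_fin_num => //.
  have /integrable_norm : lebesgue_measure.-integrable (U `\` A m)
      (EFin \o (w m \_ `[a, b])) by apply: integrableS (iw m).
  exact.
pose h m (s : R) : \bar R := ((w m s) * \1_(U m `\` A m) s)%:E.
have h0 m s : (0 <= h m s)%E by rewrite lee_fin mulr_ge0.
have mUA m : measurable (U m `\` A m).
  by apply: measurableD => //; apply: open_measurable; have [] := HU m.
have mw m : measurable_fun `[a, b] (w m).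
  apply: measurable_funD => //; first exact: measurableT_comp.
have mh m : measurable_fun `[a, b] (h m).
  by apply/measurable_EFinP; apply: measurable_funM => //; exact: measurable_indic.
pose W s : \bar R := (\sum_(m <oo) h m s)%E.
have W0 s : (0 <= W s)%E by exact: nneseries_ge0.
have mW : measurable_fun `[a, b] W by exact: ge0_emeasurable_sum.
have hW m s : (h m s <= W s)%E.
  by rewrite /W (@nneseriesD1 _ _ m xpredT)// leeDl// nneseries_ge0.
have IW : (\int[lebesgue_measure]_(s in `[a, b]) W s <= e%:E)%E.
  rewrite integral_nneseries//.
  apply: le_trans (epsilon_trick0 xpredT (ltW e0)); apply: lee_nneseries => // m _.
    have := @integral_ge0 _ _ _ lebesgue_measure `[a, b]%classic (h m) (fun s _ => h0 m s).
    exact.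
  have [_ _] := HU m; apply: le_trans.
  rewrite integral_mkcond [leRHS]integral_mkcond; apply: ge0_le_integral => //.
  - by move=> s _; apply: erestrict_ge0 => s1 _; exact: h0.
  - by apply/measurable_restrict => //; rewrite setTI; exact: mh.
  - apply/(measurable_restrict _ (mUA m)) => //; rewrite setTI.
    exact: measurable_funS (measurable_int _ (iw m)).
  - move=> s _; rewrite !patchE /h indicE.
    by case: ifP => sD; case: ifP => sU; rewrite ?mulr1 ?mulr0// lee_fin ?patchE ?sD.
exists (fun s => (g s + 2 * e)%:E + W s)%E.
have mg2 : measurable_fun `[a, b] (fun s => (g s + 2 * e)%:E).
  by apply/measurable_EFinP; apply: measurable_funD.
have ic (k : R) : lebesgue_measure.-integrable `[a, b] (EFin \o cst k).
  apply: measurable_bounded_integrable => //.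
  - by apply: le_lt_trans muD _; exact: ltry.
  - exact: bounded_cst.
have ig2 : lebesgue_measure.-integrable `[a, b] (fun s => (g s + 2 * e)%:E).
  rewrite (_ : (fun s => _) = (EFin \o g) \+ (EFin \o cst (2 * e)%R))%E; last first.
    by apply/funext.
  exact: integrableD.
have iW : lebesgue_measure.-integrable `[a, b] W.
  apply/integrableP; split => //.
  under eq_integral do rewrite gee0_abs//.
  by apply: le_lt_trans IW _; exact: ltry.
split.
- exact: integrableD.
- move=> x xD; pose m := pickle (Num.floor (g x / e)).
  have Ax : A m x.
    split => //=; rewrite in_itv /= /z pickleK /=.
    by rewrite -ler_pdivlMr// -ltr_pdivrMr// floor_le/= -(intrD1) floorD1_gt.
  have [oU AU _] := HU m.
  have : nbhs x (U m) by exact/open_nbhs_nbhs/(conj oU)/AU.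
  apply: filterS => s Us sD.
  have gx : g x < (z m + 1) * e by case: Ax => _ /=; rewrite in_itv /= => /andP[].
  have [sA|sA] := pselect (A m s).
    case: (sA) => _ /=; rewrite in_itv /= => /andP[gs _].
    rewrite -[leLHS]adde0; apply: leeD => //; rewrite lee_fin.
    have : z m * e <= g s by [].
    rewrite mulrDl mul1r in gx; lra.
  apply: (@le_trans _ _ ((g s + 2 * e)%:E + h m s)%E); last exact: leeD2l.
  rewrite /h indicE mem_set// mulr1 -EFinD lee_fin /w.
  have := ler_norm (- g s); rewrite normrN => gs.
  have zz : z m * e <= `|z m| * e by rewrite ler_wpM2r ?ler_norm// ltW.
  rewrite mulrDl mul1r in gx; rewrite mulrDl; lra.
- rewrite integralD//.
  rewrite (eq_integral (fun s : measurableTypeR R => (g s)%:E + (cst (2 * e)%R s)%:E)%E); last by [].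
  rewrite (integralD _ ig (ic (2 * e)))// EFinD [leRHS]addeA; apply: leeD => //.
  apply: leeD2l.
  rewrite [leLHS](_ : _ = (2 * e)%:E * lebesgue_measure (`[a, b]%classic : set R))%E.
    by rewrite [leRHS]EFinM lee_pmul2l// lte_fin mulr_gt0.
  exact: (integral_cst _ _ (2 * e)%:E).
Qed.

(** The definition of the derivative with the quotient cleared, so that it
    includes [s = x]. *)
Lemma derivable_near_slope (R : realType) (f : R -> R) (x e : R) :
  derivable f x 1 -> 0 < e ->
  \forall s \near x, `|f s - f x - derive1 f x * (s - x)| <= e * `|s - x|.
Proof.
move=> df e0.
have /cvgrPdist_le /(_ e e0) [d /= d0 Hd] :
    (fun h => h^-1 *: (f (h + x) - f x)) @ 0^' --> derive1 f x.
  rewrite derive1E; have := df; rewrite /derivable => /cvg_ex [l Hl].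
  have -> : 'D_1 f x = l by apply: cvg_lim.
  by move: Hl; under eq_fun do rewrite /GRing.scale /= mulr1.
exists d => //= s; rewrite /ball_ /= => xs.
have [->|sx] := eqVneq s x; first by rewrite !subrr mulr0 subr0 normr0 mulr0.
have sx0 : s - x != 0 by rewrite subr_eq0.
have := Hd (s - x); rewrite /= sub0r normrN -[X in X < d]distrC => /(_ xs sx0).
rewrite subrK => H.
have -> : f s - f x - derive1 f x * (s - x) =
    - ((derive1 f x - (s - x)^-1 *: (f s - f x)) * (s - x)).
  by rewrite /GRing.scale /=; field.
rewrite normrN normrM; exact: ler_wpM2r.
Qed.

(** A property of intervals that is additive and holds near every point holds on
    [[a, b]]: otherwise the supremum of the [y] with [P a y] could be exceeded.
    The local condition only concerns intervals having the point as an endpoint,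
    where the slope of a function is close to its derivative. *)
Lemma cousin_chain (R : realType) (a b : R) (P : R -> R -> Prop) :
  a <= b ->
  (forall x y z, x <= y -> y <= z -> a <= x -> z <= b ->
    P x y -> P y z -> P x z) ->
  (forall x, a <= x <= b -> \forall s \near x, a <= s <= b ->
    (s <= x -> P s x) /\ (x <= s -> P x s)) ->
  P a b.
Proof.
move=> ab Ptr Ploc.
pose S : set R := [set y | a <= y <= b /\ P a y].
have Pa : P a a.
  have := Ploc a; rewrite lexx ab => /(_ isT) /nbhs_singleton.
  by rewrite lexx ab => /(_ isT)[+ _]; apply.
have Sa : S a by split => //; rewrite lexx ab.
have hS : has_sup S.
  by split; [exists a|exists b => y [/andP[]]].
pose s := sup S.
have as_ : a <= s by apply: ub_le_sup Sa; case: hS.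
have sb : s <= b by apply: ge_sup; [exists a|move=> y [/andP[]]].
have [d /= d0 Hd] : nbhs s [set t | a <= t <= b ->
    (t <= s -> P t s) /\ (s <= t -> P s t)] by apply: Ploc; rewrite as_.
have Ps : P a s.
  have [x Sx sx] := sup_adherent d0 hS.
  have xs : x <= s by apply: ub_le_sup Sx; case: hS.
  case: (Sx) => /andP[ax xb] Pax.
  apply: (Ptr a x s) => //.
  have : ball s d x by rewrite /ball /= ger0_norm ?subr_ge0// ltrBlDl -ltrBlDr.
  by move=> /Hd /=; rewrite ax xb => /(_ isT)[+ _]; apply.
have [sltb|] := ltP s b; last by move=> bs; rewrite (_ : b = s)//; apply/eqP; rewrite eq_le bs.
exfalso.
pose t := Num.min b (s + d / 2).
have st : s < t by rewrite lt_min sltb ltrDl divr_gt0.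
have tb : t <= b by rewrite ge_min lexx.
have td : t <= s + d / 2 by rewrite ge_min lexx orbT.
have at_ : a <= t by apply: le_trans as_ (ltW st).
have : ball s d t.
  rewrite /ball /= distrC gtr0_norm ?subr_gt0// ltrBlDl.
  by apply: le_lt_trans td _; rewrite ltrD2l ltr_pdivrMr// ltr_pMr// ltr1n.
move=> /Hd /=; rewrite at_ tb => /(_ isT)[_ /(_ (ltW st)) Pst].
have Pat : P a t by apply: (Ptr a s t) => //; exact: ltW.
have : t <= s by apply: ub_le_sup; [case: hS|split => //; rewrite at_].
by rewrite leNgt st.
Qed.

(** With [Phi] from [vitali_caratheodory], near every [x] the slope of [f] from
    [x] is at most [f' x + e <= Phi], so the increment of [f] is at most the
    integral of [Phi] on small intervals ending at [x]; these inequalities add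
    up along a chain. *)
Lemma derivable_le_integral (R : realType) (f : R -> R) (a b : R) :
  a <= b -> (forall x, a <= x <= b -> derivable f x 1) ->
  lebesgue_measure.-integrable `[a, b] (EFin \o derive1 f) ->
  ((f b - f a)%:E <= \int[lebesgue_measure]_(s in `[a, b]) (derive1 f s)%:E)%E.
Proof.
move=> ab df idf; apply/lee_addgt0Pr => k k0.
(* With this [e] the excess of the integral of [Phi] is exactly [k]. *)
pose e := k / (2 * `|b - a| + 1).
have ba1 : 0 < 2 * `|b - a| + 1 by rewrite ltr_wpDl// mulr_ge0.
have e0 : 0 < e by rewrite divr_gt0.
have [Phi [iPhi Phi_ge Phi_int]] := vitali_caratheodory e0 idf.
have -> : k = 2 * e * `|b - a| + e by rewrite /e; field; rewrite gt_eqF.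
apply: le_trans Phi_int.
rewrite -integral_itv_obnd_cbnd; last first.
  by apply: measurable_funS (measurable_int _ iPhi) => //; exact: subset_itv_oc_cc.
pose P x y := ((f y - f x)%:E <= \int[lebesgue_measure]_(s in `]x, y]) Phi s)%E.
have iPhiS x y : a <= x -> y <= b -> lebesgue_measure.-integrable `]x, y] Phi.
  move=> ax yb; apply: integrableS iPhi => //.
  move=> s /=; rewrite !in_itv /= => /andP[xs sy].
  by rewrite (le_trans ax (ltW xs)) (le_trans sy yb).
have Plin x y (c : R) : a <= x -> x <= y -> y <= b -> f y - f x <= c * (y - x) ->
    (forall s, x < s <= y -> (c%:E <= Phi s)%E) -> P x y.
  move=> ax xy yb fxy cPhi; rewrite /P.
  apply: (@le_trans _ _ (\int[lebesgue_measure]_(s in `]x, y]) (cst c%:E) s)%E).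
    rewrite integral_cst//= lebesgue_measure_itv /= lte_fin.
    case: ltP => [_|yx]; first by rewrite -EFinB -EFinM lee_fin.
    have -> : y = x by apply/eqP; rewrite eq_le yx.
    by rewrite subrr mule0.
  have ic : lebesgue_measure.-integrable `]x, y] (EFin \o cst c).
    apply: measurable_bounded_integrable => //.
    - rewrite /= lebesgue_measure_itv /=; case: ifP => _; last exact: ltry.
      by rewrite -EFinB ltry.
    - exact: bounded_cst.
  apply: le_integral => //; first exact: iPhiS.
  by move=> s; rewrite inE /= in_itv /=; exact: cPhi.
apply: (cousin_chain ab (P := P)).
- move=> x y t xy yt ax tb Pxy Pyt; rewrite /P.
  rewrite (_ : `]x, t]%classic = `]x, y] `|` `]y, t]); last first.
    by rewrite -itv_bndbnd_setU.
  rewrite integral_setU//; last 2 first.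
  + have := measurable_int _ (iPhiS x t ax tb).
    by rewrite (@itv_bndbnd_setU _ _ _ (BRight y))//.
  + apply/disj_set2P; rewrite -subset0 => s /=; rewrite !in_itv /=.
    by move=> [/andP[_ sy] /andP[ys _]]; rewrite ltNge sy in ys.
  rewrite (_ : f t - f x = (f y - f x) + (f t - f y)); last by ring.
  by rewrite EFinD; exact: leeD.
- move=> x /andP[ax xb].
  have xD : x \in `[a, b] by rewrite in_itv /= ax.
  have dfx : derivable f x 1 by apply: df; rewrite ax.
  have [d /= d0 Hd] : nbhs x [set s |
      `|f s - f x - derive1 f x * (s - x)| <= e * `|s - x| /\
      (s \in `[a, b] -> ((derive1 f x + e)%:E <= Phi s)%E)].
    apply: filterI; first exact: (derivable_near_slope dfx e0).
    exact: Phi_ge.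
  exists d => //= s xs /andP[as_ sb]; have [Hs _] := Hd _ xs; split => sx.
  + apply: (@Plin _ _ (derive1 f x + e)) => //.
    * move: Hs; rewrite (ler0_norm (x := s - x)) ?subr_le0// ler_norml => /andP[+ _].
      lra.
    * move=> u /andP[su ux]; apply: (Hd u _).2.
        rewrite /= ger0_norm ?subr_ge0//; move: xs; rewrite /= ger0_norm ?subr_ge0//.
        by apply: le_lt_trans; rewrite lerD2l lerN2 ltW.
      by rewrite in_itv /= (le_trans as_ (ltW su)) (le_trans ux xb).
  + apply: (@Plin _ _ (derive1 f x + e)) => //.
    * move: Hs; rewrite (ger0_norm (x := s - x)) ?subr_ge0// ler_norml => /andP[_].
      lra.
    * move=> u /andP[xu us]; apply: (Hd u _).2.
        rewrite /= distrC gtr0_norm ?subr_gt0//; move: xs; rewrite /= distrC ger0_norm ?subr_ge0//.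
        by apply: le_lt_trans; rewrite lerD2r.
      by rewrite in_itv /= (le_trans ax (ltW xu)) (le_trans us sb).
Qed.

(** [derivable_le_integral] for [f] and for [- f]. *)
Lemma integral_derive1 (R : realType) (f : R -> R) (a b : R) :
  a <= b -> (forall x, a <= x <= b -> derivable f x 1) ->
  lebesgue_measure.-integrable `[a, b] (EFin \o derive1 f) ->
  \int[lebesgue_measure]_(s in `[a, b]) derive1 f s = f b - f a.
Proof.
move=> ab df idf.
have dN x : a <= x <= b -> derive1 (- f) x = - derive1 f x.
  by move=> xab; rewrite !derive1E deriveN//; exact: df.
have fin : (\int[lebesgue_measure]_(s in `[a, b]) (derive1 f s)%:E)%E \is a fin_num.
  exact: integrable_fin_num.
apply/eqP; rewrite eq_le; apply/andP; split; last first.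
  rewrite -lee_fin /Rintegral fineK//; exact: derivable_le_integral.
have := @derivable_le_integral R (- f) a b ab.
have -> : (\int[lebesgue_measure]_(s in `[a, b]) (derive1 (- f) s)%:E =
    - \int[lebesgue_measure]_(s in `[a, b]) (derive1 f s)%:E)%E.
  rewrite -integralN; last exact: integrable_add_def.
  by apply: eq_integral => s; rewrite inE /= in_itv /= => sab; rewrite dN// EFinN.
move=> H; rewrite -lerN2 -lee_fin [leRHS]EFinN /Rintegral fineK//.
rewrite (_ : - (f b - f a) = (- f) b - (- f) a); last by rewrite !fctE; ring.
apply: H.
- by move=> x xab; apply: derivableN; exact: df.
- have : lebesgue_measure.-integrable `[a, b] (-%E \o (EFin \o derive1 f))%E.
    exact: integrableN.
  apply: eq_integrable => // s.
  by rewrite inE /= in_itv /= => sab; rewrite dN.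
Qed.

(** * The semigroup law of fractional integration *)

Lemma patch_posE (R : realType) (g : R -> R) (u : R) :
  (g \_ `]0, +oo[) u = if 0 < u then g u else 0.
Proof. by rewrite patchE; congr (if _ then _ else _); apply/idP/idP; rewrite inE /= in_itv /= andbT. Qed.

Lemma patch_ooE (R : realType) (g : R -> R) (t u : R) :
  (g \_ `]0, t[) u = if 0 < u < t then g u else 0.
Proof. by rewrite patchE; congr (if _ then _ else _); apply/idP/idP; rewrite inE /= in_itv. Qed.

(** The integrand of [RL_integral s g t] on the whole line, the indicator of
    [(0, t)] being split between the kernel ([u < t]) and [g] ([0 < u]). *)
Definition rl_conv (R : realType) (s : R) (g : R -> R) (t u : R) : R :=
  rl_ker s (t - u) * (g \_ `]0, +oo[) u.

Lemma rl_convE (R : realType) (s : R) (g : R -> R) (t : R) :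
  rl_conv s g t = (fun u => (Gamma s)^-1 * RL_kernel s g t u) \_ `]0, t[.
Proof.
apply/funext => u; rewrite /rl_conv patch_posE patch_ooE /RL_kernel !rl_kerE /pospow.
rewrite subr_gt0; have [u0|u0] /= := ltP 0 u; last by rewrite mulr0.
have [ut|ut] := ltP u t; last by rewrite !mul0r.
by rewrite mulrA; congr (_ * _); rewrite mulrC.
Qed.

Lemma norm_rl_conv (R : realType) (s : R) (g : R -> R) (t u : R) : 0 < s ->
  `|rl_conv s g t u| = rl_ker s (t - u) * `|(g \_ `]0, +oo[) u|.
Proof. by move=> s0; rewrite /rl_conv normrM ger0_norm// rl_ker_ge0. Qed.

Lemma integrable_rl_conv (R : realType) (s : R) (g : R -> R) (t : R) : 0 < s ->
  lebesgue_measure.-integrable `]0, t[ (EFin \o RL_kernel s g t) <->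
  lebesgue_measure.-integrable setT (EFin \o rl_conv s g t).
Proof.
move=> s0; have G0 := Gamma_gt0 s0.
have -> : EFin \o rl_conv s g t = (EFin \o (fun u => (Gamma s)^-1 * RL_kernel s g t u)) \_ `]0, t[.
  by rewrite rl_convE restrict_EFin.
have mD : measurable (`]0, t[%classic : set R) by exact: measurable_itv.
split => [ik|].
  apply/integrable_restrict => //; rewrite setTI.
  rewrite (_ : EFin \o _ = (fun u => ((Gamma s)^-1)%:E * (EFin \o RL_kernel s g t) u)%E)//.
  exact: integrableZl.
move=> ik0.
have ik : lebesgue_measure.-integrable `]0, t[
    (EFin \o (fun u => (Gamma s)^-1 * RL_kernel s g t u)).
  by apply/integrable_mkcond.
rewrite (_ : EFin \o _ = (fun u => (Gamma s)%:E *
   (EFin \o (fun v => (Gamma s)^-1 * RL_kernel s g t v)%R) u)%E).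
  exact: integrableZl.
by apply/funext => u /=; rewrite -EFinM mulVKf// gt_eqF.
Qed.

Lemma RL_integralE (R : realType) (s : R) (g : R -> R) (t : R) : 0 < s ->
  lebesgue_measure.-integrable setT (EFin \o rl_conv s g t) ->
  RL_integral s g t = \int[lebesgue_measure]_u rl_conv s g t u.
Proof.
move=> s0 ir; have ik := (integrable_rl_conv g t s0).2 ir.
by rewrite /RL_integral gt_eqF// rl_convE -Rintegral_mkcond RintegralZl.
Qed.

Lemma RL_integrableP (R : realType) (s : R) (g : R -> R) : 0 < s ->
  RL_integrable s g <->
  forall t : R, 0 < t -> lebesgue_measure.-integrable setT (EFin \o rl_conv s g t).
Proof.
move=> s0; split => [H t t0|H _ t t0].
  by apply/integrable_rl_conv => //; apply: H => //; rewrite gt_eqF.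
by apply/integrable_rl_conv => //; exact: H.
Qed.

Lemma measurable_rl_shift (R : realType) (s t : R) (D : set R) :
  measurable_fun D (fun u => rl_ker s (t - u)).
Proof.
apply: measurable_funTS.
apply: (measurableT_comp (measurable_rl_ker s (D := setT))).
exact: measurable_funB.
Qed.

(** [RL_integrable] only makes the products with kernels measurable; dividing by
    the positive kernel recovers [g] on every [(0, n)]. *)
Lemma measurable_RL_integrable (R : realType) (s : R) (g : R -> R) : 0 < s ->
  (forall t : R, 0 < t -> lebesgue_measure.-integrable setT (EFin \o rl_conv s g t)) ->
  measurable_fun setT (g \_ `]0, +oo[).
Proof.
move=> s0 H; apply/(measurable_restrictT _ _).1 => //.
have -> : (`]0, +oo[%classic : set R) = \bigcup_n `]0, (n.+1%:R : R)[%classic.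
  apply/seteqP; split => x /=.
    rewrite in_itv /= andbT => x0; exists (Num.truncn x) => //=.
    by rewrite in_itv /= x0 truncnS_gt.
  by move=> [n _]; rewrite /= !in_itv /= => /andP[->].
apply/measurable_fun_bigcup => // n.
have n0 : 0 < n.+1%:R :> R by [].
have mk : measurable_fun `]0, (n.+1%:R : R)[ (rl_conv s g n.+1%:R).
  apply: measurable_funTS; apply/measurable_EFinP.
  exact: measurable_int (H _ n0).
apply: (eq_measurable_fun (fun u : R => rl_conv s g n.+1%:R u *
   (Gamma s * (n.+1%:R - u) `^ (1 - s)))).
  move=> u; rewrite inE /= in_itv /= => /andP[u0 un].
  rewrite /rl_conv !rl_kerE /pospow subr_gt0 un patch_posE u0.
  have nu0 : 0 < n.+1%:R - u by rewrite subr_gt0.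
  have E : (n.+1%:R - u) `^ (s - 1) * (n.+1%:R - u) `^ (1 - s) = 1.
    rewrite -powRD; last by rewrite (gt_eqF nu0) implybT.
    by rewrite (_ : s - 1 + (1 - s) = 0) ?powRr0//; ring.
  transitivity ((n.+1%:R - u) `^ (s - 1) * (n.+1%:R - u) `^ (1 - s) * g u).
    by field; rewrite gt_eqF// Gamma_gt0.
  by rewrite E mul1r.
apply: measurable_funM => //; apply: measurable_funM => //.
apply: measurable_funTS.
apply: (measurableT_comp (measurable_powR _)).
exact: measurable_funB.
Qed.

(** [x ^ s <= t ^ s] on [(0, t)]: fractional integrals of higher order are
    dominated by those of lower order. *)
Lemma rl_ker_le (R : realType) (s r t x : R) : 0 <= s -> 0 < r -> x <= t ->
  rl_ker (s + r) x <= `|t| `^ s * (Gamma r / Gamma (s + r)) * rl_ker r x.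
Proof.
move=> s0 r0 xt; have Gr := Gamma_gt0 r0.
have Gsr : 0 < Gamma (s + r) by rewrite Gamma_gt0// ltr_wpDl.
rewrite !rl_kerE; move: (Gamma r) (Gamma (s + r)) Gr Gsr => G H G0 H0.
rewrite /pospow; case: ifPn => [x0|_]; last by rewrite !mul0r mulr0.
have -> : x `^ (s + r - 1) = x `^ s * x `^ (r - 1).
  by rewrite -powRD ?addrA// (gt_eqF x0) implybT.
have -> : `|t| `^ s * (G / H) * (x `^ (r - 1) / G) = `|t| `^ s * (x `^ (r - 1) / H).
  by field; rewrite (gt_eqF G0) (gt_eqF H0).
rewrite -mulrA; apply: ler_wpM2r; first exact: divr_ge0 (powR_ge0 _ _) (ltW H0).
apply: ge0_ler_powR; rewrite ?nnegrE ?(ltW x0)//.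
exact: le_trans xt (ler_norm _).
Qed.

Lemma rl_conv_le (R : realType) (s r : R) (g : R -> R) (t u : R) : 0 <= s -> 0 < r ->
  `|rl_conv (s + r) g t u| <=
  `|t| `^ s * (Gamma r / Gamma (s + r)) * `|rl_conv r g t u|.
Proof.
move=> s0 r0; rewrite !norm_rl_conv ?ltr_wpDl// mulrA patch_posE.
case: ifPn => [u0|_]; last by rewrite normr0 !mulr0.
by apply: ler_wpM2r => //; apply: rl_ker_le => //; rewrite gerBl ltW.
Qed.

Lemma integrable_rl_conv_add (R : realType) (s r : R) (g : R -> R) (t : R) :
  0 <= s -> 0 < r -> measurable_fun setT (g \_ `]0, +oo[) ->
  lebesgue_measure.-integrable setT (EFin \o rl_conv r g t) ->
  lebesgue_measure.-integrable setT (EFin \o rl_conv (s + r) g t).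
Proof.
move=> s0 r0 mg ir.
pose c := `|t| `^ s * (Gamma r / Gamma (s + r)).
have c0 : 0 <= c.
  by rewrite mulr_ge0 ?powR_ge0// divr_ge0// ltW// Gamma_gt0// ltr_wpDl.
apply: (@le_integrable _ _ _ lebesgue_measure setT measurableT _
  (fun u => c%:E * (EFin \o rl_conv r g t) u)%E); last exact: integrableZl.
- apply/measurable_EFinP; apply: measurable_funM => //.
  exact: measurable_rl_shift.
- move=> u _; rewrite /= lee_fin [leRHS](_ : _ = c * `|rl_conv r g t u|).
    exact: rl_conv_le.
  by rewrite normrM (ger0_norm c0).
Qed.

(** [conv_rl_ker] after the translation [u = x + v]. *)
Lemma conv_rl_ker_shift (R : realType) (s r t v : R) : 0 < s -> 0 < r ->
  (\int[lebesgue_measure]_u (rl_ker s (t - u) * rl_ker r (u - v))%:E =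
   (rl_ker (s + r) (t - v))%:E)%E.
Proof.
move=> s0 r0; rewrite -(conv_rl_ker _ s0 r0) (@ge0_integral_affine _ 1 v); last 3 first.
- exact: oner_neq0.
- apply/measurable_EFinP; apply: measurable_funM; first exact: measurable_rl_shift.
  apply: (measurableT_comp (measurable_rl_ker r (D := setT))).
  exact: measurable_funB.
- by move=> u; rewrite lee_fin mulr_ge0// rl_ker_ge0.
rewrite normr1 mul1e; apply: eq_integral => u _; rewrite mul1r addrK.
by rewrite (_ : t - (u + v) = t - v - u)//; ring.
Qed.

(** Fubini for [rl_ker s (t - u) * rl_ker r (u - v) * g v]: the inner integral
    in [u] is [rl_ker (s + r) (t - v)].  The absolute convergence needed comes
    from the same computation with [`|g v|], as integrability at order [r]
    implies it at order [s + r]. *)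
Lemma RL_semigroup (R : realType) (s r : R) (g : R -> R) (t : R) :
  0 < s -> 0 < r -> 0 < t ->
  (forall u : R, 0 < u -> lebesgue_measure.-integrable setT (EFin \o rl_conv r g u)) ->
  lebesgue_measure.-integrable setT (EFin \o rl_conv s (RL_integral r g) t) /\
  RL_integral s (RL_integral r g) t = RL_integral (s + r) g t.
Proof.
move=> s0 r0 t0 ir; have sr0 : 0 < s + r by exact: addr_gt0.
have mg := measurable_RL_integrable r0 ir.
have isr := integrable_rl_conv_add (ltW s0) r0 mg (ir _ t0).
pose g0 := g \_ `]0, +oo[.
pose F (z : measurableTypeR R * measurableTypeR R) : \bar R :=
  (rl_ker s (t - z.1) * (rl_ker r (z.1 - z.2) * g0 z.2))%:E.
have mF : measurable_fun setT F.
  apply/measurable_EFinP; apply: measurable_funM.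
    apply: (measurableT_comp (measurable_rl_shift s t (D := setT))).
    exact: measurable_fst.
  apply: measurable_funM.
    apply: (measurableT_comp (measurable_rl_ker r (D := setT))).
    by apply: measurable_funB; [exact: measurable_fst|exact: measurable_snd].
  by apply: (measurableT_comp mg); exact: measurable_snd.
have F2 v : (\int[lebesgue_measure]_u `|F (u, v)| =
    `|(rl_conv (s + r) g t v)%:E|)%E.
  rewrite (eq_integral (fun u : measurableTypeR R => `|g0 v|%:E *
     (rl_ker s (t - u) * rl_ker r (u - v))%R%:E)%E); last first.
    move=> u _; rewrite -EFinM /F /= mulrA normrM ger0_norm.
      by congr EFin; rewrite mulrC.
    by rewrite mulr_ge0// rl_ker_ge0.
  rewrite ge0_integralZl//; last 2 first.
  - apply/measurable_EFinP; apply: measurable_funM; first exact: measurable_rl_shift.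
    apply: (measurableT_comp (measurable_rl_ker r (D := setT))).
    exact: measurable_funB.
  - by move=> u _; rewrite lee_fin mulr_ge0// rl_ker_ge0.
  by rewrite conv_rl_ker_shift// -EFinM /= norm_rl_conv// mulrC.
have iF : (lebesgue_measure \x lebesgue_measure)%E.-integrable setT F.
  apply/integrable21ltyP => //.
  rewrite (eq_integral (fun v : measurableTypeR R => `|(EFin \o rl_conv (s + r) g t) v|%E)).
    by move/integrableP : isr => [].
  by move=> v _; rewrite F2.
have F1 u : (\int[lebesgue_measure]_v F (u, v) =
    (rl_conv s (RL_integral r g) t u)%:E)%E.
  have [u0|u0] := ltP 0 u; last first.
    rewrite integral0_eq => [|v _].
      by rewrite /rl_conv patch_posE ltNge u0 mulr0.
    rewrite /F /= /g0 patch_posE; case: ifPn => [v0|_]; last by rewrite !mulr0.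
    rewrite [rl_ker r _]rl_kerE /pospow subr_gt0 ltNge.
    by rewrite (le_trans u0 (ltW v0)) /= !mul0r mulr0.
  rewrite {1}/rl_conv patch_posE u0.
  rewrite (RL_integralE r0 (ir _ u0)) EFinM /Rintegral fineK; last first.
    exact: integrable_fin_num (ir _ u0).
  by rewrite -(integralZl _ (ir _ u0)).
have F3 v : (\int[lebesgue_measure]_u F (u, v) =
    (rl_conv (s + r) g t v)%:E)%E.
  rewrite (eq_integral (fun u : measurableTypeR R => (g0 v)%:E *
     (rl_ker s (t - u) * rl_ker r (u - v))%R%:E)%E); last first.
    by move=> u _; rewrite -EFinM /F /= mulrA mulrC.
  rewrite integralZl//.
    by rewrite conv_rl_ker_shift// -EFinM mulrC.
  apply/integrableP; split.
    apply/measurable_EFinP; apply: measurable_funM; first exact: measurable_rl_shift.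
    apply: (measurableT_comp (measurable_rl_ker r (D := setT))).
    exact: measurable_funB.
  rewrite (eq_integral (fun u : measurableTypeR R =>
     (rl_ker s (t - u) * rl_ker r (u - v))%R%:E)%E).
    by rewrite conv_rl_ker_shift// ltry.
  by move=> u _; rewrite gee0_abs// lee_fin mulr_ge0// rl_ker_ge0.
have i1 : lebesgue_measure.-integrable setT (EFin \o rl_conv s (RL_integral r g) t).
  have := integrable_fubini_F iF; rewrite /fubini_F.
  by under eq_fun do rewrite F1.
split => //; rewrite !RL_integralE// /Rintegral; congr fine.
rewrite -(eq_integral _ _ (fun u _ => F1 u)) -(eq_integral _ _ (fun u _ => F3 u)).
exact: Fubini.
Qed.

(** * Mittag-Leffler kernels *)

Lemma mlter_exponent_gt0 (R : realType) (mu th : R) (k : nat) :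
  0 < mu -> 0 < th -> 0 < mu * k%:R + th.
Proof. by move=> mu0 th0; rewrite ltr_wpDl// mulr_ge0// ltW. Qed.

(** [Gamma] outgrows every geometric sequence along an arithmetic progression:
    in [Gamma_ge] take [M ^ mu = 2 * z + 1], so that the terms decrease at least
    like [(1/2) ^ k]. *)
Lemma cvg_series_inv_Gamma (R : realType) (mu th z : R) :
  0 < mu -> 0 < th -> 0 <= z ->
  cvgn (series (fun k : nat => z ^+ k / Gamma (mu * k%:R + th))).
Proof.
move=> mu0 th0 z0; have z1 : 0 < 2 * z + 1 by rewrite ltr_wpDl// mulr_ge0.
pose M := (2 * z + 1) `^ mu^-1.
have M0 : 0 < M by exact: powR_gt0.
have Mmu : M `^ mu = 2 * z + 1.
  by rewrite /M -powRrM mulVf ?gt_eqF// powRr1// ltW.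
have M1 : 0 < M + 1 by rewrite addr_gt0.
pose K := M `^ th * (expR (- (M + 1)) / (M + 1)).
have K0 : 0 < K by rewrite mulr_gt0 ?powR_gt0// divr_gt0// expR_gt0.
apply: (@series_le_cvg _ _ (geometric K^-1 (2^-1))).
- move=> k; rewrite divr_ge0 ?exprn_ge0// ltW// Gamma_gt0//.
  exact: mlter_exponent_gt0.
- by move=> k; rewrite /geometric /= mulr_ge0 ?exprn_ge0 ?invr_ge0// ltW.
- move=> k; have sk := mlter_exponent_gt0 k mu0 th0.
  have GK : (2 * z + 1) ^+ k * K <= Gamma (mu * k%:R + th).
    have -> : (2 * z + 1) ^+ k * K = M `^ (mu * k%:R + th) * (expR (- (M + 1)) / (M + 1)).
      rewrite powRD; last by rewrite (gt_eqF M0) implybT.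
      rewrite powRrM Mmu powR_mulrn ?(ltW z1)// /K; ring.
    exact: Gamma_ge.
  have zK0 : 0 < (2 * z + 1) ^+ k * K by rewrite mulr_gt0 ?exprn_gt0.
  rewrite /geometric /= ler_pdivrMr ?Gamma_gt0//.
  apply: (@le_trans _ _ (K^-1 * 2^-1 ^+ k * ((2 * z + 1) ^+ k * K))); last first.
    by rewrite ler_wpM2l// mulr_ge0 ?exprn_ge0 ?invr_ge0// ltW.
  have -> : K^-1 * 2^-1 ^+ k * ((2 * z + 1) ^+ k * K) = (2^-1 * (2 * z + 1)) ^+ k.
    by rewrite exprMn; field; rewrite gt_eqF.
  by rewrite lerXn2r ?nnegrE// ?mulr_ge0// ?(ltW z1)//; lra.
- by apply: is_cvg_geometric_series; rewrite ger0_norm// invf_lt1// ltr1n.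
Qed.

Definition ml_term (R : realType) (mu rho th t : R) (k : nat) : R :=
  rho ^+ k * rl_ker (mu * k%:R + th) t.

(** The function [t ^ (th - 1) * E_(mu, th) (rho * t ^ mu)], in the form in which
    fractional integration merely shifts [th]. *)
HB.lock Definition ml_ker (R : realType) (mu rho th t : R) : R :=
  limn (series (ml_term mu rho th t)).

Lemma ml_ker_lim (R : realType) (mu rho th t : R) :
  ml_ker mu rho th t = limn (series (ml_term mu rho th t)).
Proof. by rewrite ml_ker.unlock. Qed.

Lemma ml_termE (R : realType) (mu rho th t : R) (k : nat) : 0 < t ->
  ml_term mu rho th t k =
  t `^ (th - 1) * ((rho * t `^ mu) ^+ k / Gamma (mu * k%:R + th)).
Proof.
move=> t0; rewrite /ml_term !rl_kerE /pospow t0.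
have -> : t `^ (mu * k%:R + th - 1) = (t `^ mu) ^+ k * t `^ (th - 1).
  rewrite -powR_mulrn ?powR_ge0// -powRrM -powRD ?addrA//.
  by rewrite (gt_eqF t0) implybT.
rewrite exprMn; ring.
Qed.

Lemma norm_ml_term (R : realType) (mu rho th t : R) (k : nat) :
  0 < mu -> 0 < th -> `|ml_term mu rho th t k| = ml_term mu `|rho| th t k.
Proof.
move=> mu0 th0; rewrite /ml_term normrM normrX (ger0_norm (x := rl_ker _ _))//.
by apply: rl_ker_ge0; exact: mlter_exponent_gt0.
Qed.

Lemma ml_term_le0 (R : realType) (mu rho th t : R) (k : nat) : t <= 0 ->
  ml_term mu rho th t k = 0.
Proof. by move=> t0; rewrite /ml_term !rl_kerE /pospow ltNge t0 mul0r mulr0. Qed.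

Lemma cvg_ml_term_norm (R : realType) (mu rho th t : R) : 0 < mu -> 0 < th ->
  cvgn (series (ml_term mu `|rho| th t)).
Proof.
move=> mu0 th0; have [t0|t0] := ltP 0 t; last first.
  rewrite (_ : ml_term _ _ _ _ = (fun=> 0)); last by apply/funext => k; rewrite ml_term_le0.
  rewrite (_ : series _ = (fun=> 0)); first exact: is_cvg_cst.
  by apply/funext => n; rewrite /series /= big1.
rewrite (_ : ml_term _ _ _ _ = t `^ (th - 1) *:
  (fun k : nat => (`|rho| * t `^ mu) ^+ k / Gamma (mu * k%:R + th))); last first.
  by apply/funext => k; rewrite ml_termE.
apply: is_cvg_seriesZ; apply: cvg_series_inv_Gamma => //.
by rewrite mulr_ge0 ?powR_ge0.
Qed.

Lemma cvg_ml_term (R : realType) (mu rho th t : R) : 0 < mu -> 0 < th ->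
  cvgn (series (ml_term mu rho th t)).
Proof.
move=> mu0 th0; apply: normed_cvg.
rewrite (_ : [normed series _] = series (ml_term mu `|rho| th t)).
  exact: cvg_ml_term_norm.
by apply/funext => n; rewrite /series /=; apply: eq_bigr => k _; rewrite norm_ml_term.
Qed.

Lemma cvg_ml_ker (R : realType) (mu rho th t : R) : 0 < mu -> 0 < th ->
  series (ml_term mu rho th t) @ \oo --> ml_ker mu rho th t.
Proof. by move=> mu0 th0; rewrite ml_ker_lim; exact: cvg_ml_term. Qed.

Lemma ml_kerE (R : realType) (mu rho th t : R) : 0 < mu -> 0 < th -> 0 < t ->
  ml_ker mu rho th t = t `^ (th - 1) * mittag_leffler mu th (rho * t `^ mu).
Proof.
move=> mu0 th0 t0.
have tn0 : t `^ (th - 1) != 0 by rewrite gt_eqF// powR_gt0.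
suff -> : mittag_leffler mu th (rho * t `^ mu) = (t `^ (th - 1))^-1 * ml_ker mu rho th t.
  by rewrite mulrA mulfV// mul1r.
rewrite /mittag_leffler.
rewrite (_ : (fun k => _) = (t `^ (th - 1))^-1 *: ml_term mu rho th t); last first.
  apply/funext => k; transitivity ((t `^ (th - 1))^-1 * ml_term mu rho th t k) => //.
  by rewrite ml_termE// mulKf.
rewrite lim_seriesZ ?ml_ker_lim//; exact: cvg_ml_term.
Qed.

Lemma ml_ker_le0 (R : realType) (mu rho th t : R) : t <= 0 ->
  ml_ker mu rho th t = 0.
Proof.
move=> t0; rewrite ml_ker_lim (_ : series _ = (fun=> 0)); first exact: lim_cst.
by apply/funext => n; rewrite /series /= big1// => k _; rewrite ml_term_le0.
Qed.

(** Splitting off the first term of the series. *)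
Lemma ml_ker_recl (R : realType) (mu rho th t : R) : 0 < mu -> 0 < th ->
  ml_ker mu rho th t = rl_ker th t + rho * ml_ker mu rho (th + mu) t.
Proof.
move=> mu0 th0; rewrite [LHS]ml_ker_lim; apply: cvg_lim => //.
have thmu : 0 < th + mu by exact: addr_gt0.
rewrite -(cvg_shiftS (series _)).
rewrite (_ : (fun n => series _ n.+1) =
   (fun n => rl_ker th t + rho * series (ml_term mu rho (th + mu) t) n)); last first.
  apply/funext => n; rewrite /series /= big_nat_recl// /ml_term expr0 mul1r mulr0 add0r.
  congr (_ + _); rewrite big_distrr /=; apply: eq_bigr => k _.
  rewrite exprS mulrA; congr (_ * rl_ker _ _); rewrite -natr1; ring.
apply: cvgD; first exact: cvg_cst.
by apply: cvgM; [exact: cvg_cst|exact: cvg_ml_ker].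
Qed.

Lemma integrable_ml_term_conv (R : realType) (mu rho th s t : R) (k : nat) :
  0 < mu -> 0 < th -> 0 < s ->
  lebesgue_measure.-integrable setT
    (fun u => (rl_ker s (t - u) * ml_term mu rho th u k)%:E) /\
  (\int[lebesgue_measure]_u (rl_ker s (t - u) * ml_term mu rho th u k)%:E =
   (ml_term mu rho (th + s) t k)%:E)%E.
Proof.
move=> mu0 th0 s0; have sk := mlter_exponent_gt0 k mu0 th0.
have E u : (rl_ker s (t - u) * ml_term mu rho th u k)%:E =
   ((rho ^+ k)%:E * (rl_ker s (t - u) * rl_ker (mu * k%:R + th) u)%R%:E)%E.
  by rewrite -EFinM /ml_term mulrCA.
have ii : lebesgue_measure.-integrable setT (fun u : measurableTypeR R =>
    (rl_ker s (t - u) * rl_ker (mu * k%:R + th) u)%:E).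
  apply/integrableP; split.
    apply/measurable_EFinP; apply: measurable_funM; first exact: measurable_rl_shift.
    exact: measurable_rl_ker.
  rewrite (eq_integral (fun u : measurableTypeR R =>
     (rl_ker s (t - u) * rl_ker (mu * k%:R + th) u)%R%:E)%E).
    by rewrite conv_rl_ker// ltry.
  by move=> u _; rewrite gee0_abs// lee_fin mulr_ge0// rl_ker_ge0.
split; first by under eq_fun do rewrite E; exact: integrableZl.
under eq_integral do rewrite E.
rewrite integralZl// (conv_rl_ker _ s0 sk) -EFinM /ml_term; congr (_ * rl_ker _ _)%:E.
by ring.
Qed.

Lemma measurable_ml_ker (R : realType) (mu rho th : R) (D : set R) :
  0 < mu -> 0 < th -> measurable_fun D (ml_ker mu rho th).
Proof.
move=> mu0 th0; apply: measurable_funTS.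
apply: (@measurable_fun_cvg _ _ R setT
  (fun n (u : R) => series (ml_term mu rho th u) n)).
  move=> n; rewrite /series /=; apply: measurable_sum => k.
  by apply: measurable_funM => //; exact: measurable_rl_ker.
by move=> u _; exact: cvg_ml_ker.
Qed.

(** Term by term integration, dominated by the series with [`|rho|]. *)
Lemma RL_ml_ker (R : realType) (mu rho th s t : R) :
  0 < mu -> 0 < th -> 0 < s ->
  lebesgue_measure.-integrable setT (EFin \o rl_conv s (ml_ker mu rho th) t) /\
  RL_integral s (ml_ker mu rho th) t = ml_ker mu rho (th + s) t.
Proof.
move=> mu0 th0 s0; have ths : 0 < th + s by exact: addr_gt0.
have term0 u k : 0 <= ml_term mu `|rho| th u k.
  by rewrite -norm_ml_term.
pose f (n : nat) (u : measurableTypeR R) : \bar R :=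
  (\sum_(0 <= k < n) (rl_ker s (t - u) * ml_term mu rho th u k)%:E)%E.
pose F (u : measurableTypeR R) : \bar R := (rl_ker s (t - u) * ml_ker mu rho th u)%:E.
pose G (u : measurableTypeR R) : \bar R := (rl_ker s (t - u) * ml_ker mu `|rho| th u)%:E.
have convE : EFin \o rl_conv s (ml_ker mu rho th) t = F.
  apply/funext => u; rewrite /F /= /rl_conv patch_posE; congr (_ * _)%:E.
  by case: ltP => // u0; rewrite ml_ker_le0.
have fE n u : f n u = (rl_ker s (t - u) * series (ml_term mu rho th u) n)%:E.
  by rewrite /f sumEFin /series /= big_distrr.
have mG : measurable_fun setT G.
  apply/measurable_EFinP; apply: measurable_funM; first exact: measurable_rl_shift.
  exact: measurable_ml_ker.
have GE u : G u = (\sum_(k <oo) (rl_ker s (t - u) * ml_term mu `|rho| th u k)%:E)%E.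
  apply/esym/cvg_lim => //.
  rewrite (_ : (fun n => _) = EFin \o
     (fun n => rl_ker s (t - u) * series (ml_term mu `|rho| th u) n)); last first.
    by apply/funext => n; rewrite sumEFin /series /= big_distrr.
  apply: cvg_EFin; first exact: nearW.
  by apply: cvgM; [exact: cvg_cst|exact: cvg_ml_ker].
have iG : lebesgue_measure.-integrable setT G.
  apply/integrableP; split => //.
  rewrite (eq_integral (fun u : measurableTypeR R =>
    \sum_(k <oo) (rl_ker s (t - u) * ml_term mu `|rho| th u k)%R%:E)%E); last first.
    move=> u _; rewrite GE gee0_abs// nneseries_ge0// => k _ _.
    by rewrite lee_fin mulr_ge0// rl_ker_ge0.
  rewrite integral_nneseries//; last 2 first.
  - move=> k; apply/measurable_EFinP; apply: measurable_funM; first exact: measurable_rl_shift.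
    by apply: measurable_funM => //; exact: measurable_rl_ker.
  - by move=> k u _; rewrite lee_fin mulr_ge0// rl_ker_ge0.
  rewrite (eq_eseriesr (g := fun k => (ml_term mu `|rho| (th + s) t k)%:E)); last first.
    by move=> k _; rewrite (integrable_ml_term_conv _ _ _ mu0 th0 s0).2.
  rewrite (_ : limn _ = (ml_ker mu `|rho| (th + s) t)%:E) ?ltry//.
  apply: cvg_lim => //.
  rewrite (_ : (fun n => _) = EFin \o series (ml_term mu `|rho| (th + s) t)); last first.
    by apply/funext => n; rewrite sumEFin.
  by apply: cvg_EFin; [exact: nearW|exact: cvg_ml_ker].
have [] := @dominated_convergence _ _ R lebesgue_measure setT measurableT f F G.
- move=> n; apply: emeasurable_sum => k.
  exact: (measurable_int _ (integrable_ml_term_conv _ _ _ mu0 th0 s0).1).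
- apply/measurable_EFinP; apply: measurable_funM; first exact: measurable_rl_shift.
  exact: measurable_ml_ker.
- apply/aeW => u _.
  rewrite (_ : f ^~ u = EFin \o
     (fun n => rl_ker s (t - u) * series (ml_term mu rho th u) n)); last first.
    by apply/funext => n; rewrite fE.
  apply: cvg_EFin; first exact: nearW.
  by apply: cvgM; [exact: cvg_cst|exact: cvg_ml_ker].
- exact: iG.
- apply/aeW => u n _; rewrite fE /= normrM (ger0_norm (rl_ker_ge0 _ s0)) lee_fin.
  apply: ler_wpM2l; first exact: rl_ker_ge0.
  apply: (@le_trans _ _ (series (ml_term mu `|rho| th u) n)).
    rewrite /series /=; apply: le_trans (ler_norm_sum _ _ _) _.
    by apply: ler_sum => k _; rewrite norm_ml_term.
  rewrite ml_ker_lim; apply: nondecreasing_cvgn_le; last exact: cvg_ml_term.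
  exact: nondecreasing_series.
move=> iF _ cF; split; first by rewrite convE.
rewrite RL_integralE//; last by rewrite convE.
rewrite /Rintegral.
have -> : (\int[lebesgue_measure]_u (rl_conv s (ml_ker mu rho th) t u)%:E =
   (ml_ker mu rho (th + s) t)%:E)%E => //.
rewrite -[X in integral _ _ X]/(EFin \o rl_conv s (ml_ker mu rho th) t) convE.
apply: (cvg_unique _ cF) => //=.
rewrite (_ : (fun n => _) = EFin \o series (ml_term mu rho (th + s) t)); last first.
  apply/funext => n; rewrite /f integral_sum//; last first.
    by move=> k; exact: (integrable_ml_term_conv _ _ _ mu0 th0 s0).1.
  rewrite /series /= -sumEFin; apply: eq_bigr => k _.
  exact: (integrable_ml_term_conv _ _ _ mu0 th0 s0).2.
by apply: cvg_EFin; [exact: nearW|exact: cvg_ml_ker].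
Qed.

Lemma RL_kernel1 (R : realType) (g : R -> R) (t : R) : RL_kernel 1 g t = g.
Proof. by apply/funext => s; rewrite /RL_kernel subrr powRr0 mul1r. Qed.

Lemma RL_integral1 (R : realType) (g : R -> R) (t : R) :
  RL_integral 1 g t = \int[lebesgue_measure]_(s in `]0, t[) g s.
Proof. by rewrite /RL_integral oner_eq0 Gamma1 invr1 mul1r RL_kernel1. Qed.

Lemma integrable_ml_ker (R : realType) (mu rho th t : R) : 0 < mu -> 0 < th ->
  lebesgue_measure.-integrable `]0, t[ (EFin \o ml_ker mu rho th).
Proof.
move=> mu0 th0; have [ii _] := RL_ml_ker rho t mu0 th0 ltr01.
by have /(integrable_rl_conv _ _ ltr01) := ii; rewrite RL_kernel1.
Qed.

Lemma integrable_ml_ker_cc (R : realType) (mu rho th t : R) : 0 < mu -> 0 < th ->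
  lebesgue_measure.-integrable `[0, t] (EFin \o ml_ker mu rho th).
Proof.
move=> mu0 th0.
have -> : ml_ker mu rho th = ml_ker mu rho th \_ `]0, +oo[.
  by apply/funext => u; rewrite patch_posE; case: ltP => // u0; rewrite ml_ker_le0.
rewrite -restrict_EFin; apply/integrable_restrict => //.
apply: integrableS (integrable_ml_ker rho (t + 1) mu0 th0) => //; first exact: measurableI.
move=> u /= []; rewrite !in_itv /= andbT => /andP[_ ut] ->.
by rewrite (le_lt_trans ut)// ltrDl.
Qed.

Lemma ml_ker_int (R : realType) (mu rho th t : R) : 0 < mu -> 0 < th -> 0 < t ->
  ml_ker mu rho (th + 1) t = \int[lebesgue_measure]_(s in `[0, t]) ml_ker mu rho th s.
Proof.
move=> mu0 th0 t0; have [_ <-] := RL_ml_ker rho t mu0 th0 ltr01.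
have icc := integrable_ml_ker_cc rho t mu0 th0.
rewrite RL_integral1 Rintegral_itv_bndo_bndc; last exact: integrable_ml_ker.
rewrite Rintegral_itv_obnd_cbnd//; apply: integrableS icc => //.
exact: subset_itv_oc_cc.
Qed.

Lemma near_eq_pos (R : realType) (f g : R -> R) (t : R) : 0 < t ->
  (forall x, 0 < x -> f x = g x) -> \forall x \near t, f x = g x.
Proof. by move=> t0 fg; near=> x; apply: fg; near: x; exact: lt_nbhsr. Unshelve. all: by end_near. Qed.

Lemma derivable_eq_pos (R : realType) (f g : R -> R) (t : R) : 0 < t ->
  (forall x, 0 < x -> f x = g x) -> derivable f t 1 -> derivable g t 1.
Proof. by move=> t0 fg; apply: near_eq_derivable; exact: near_eq_pos. Qed.

Lemma derive1_eq_pos (R : realType) (f g : R -> R) (t : R) : 0 < t ->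
  (forall x, 0 < x -> f x = g x) -> derive1 f t = derive1 g t.
Proof. by move=> t0 fg; rewrite !derive1E; apply: near_eq_derive; exact: near_eq_pos. Qed.

Lemma continuous_eq_pos (R : realType) (f g : R -> R) (t : R) : 0 < t ->
  (forall x, 0 < x -> f x = g x) -> {for t, continuous f} -> {for t, continuous g}.
Proof.
move=> t0 fg cf; rewrite /prop_for /continuous_at -fg//.
by apply: cvg_trans cf; apply: near_eq_cvg; exact: near_eq_pos.
Qed.

Lemma continuous_rl_ker (R : realType) (s t : R) : 0 < t ->
  {for t, continuous (rl_ker s)}.
Proof.
move=> t0; apply: (@continuous_eq_pos _ (fun x => x `^ (s - 1) * (Gamma s)^-1)) => //.
  by move=> x x0; rewrite !rl_kerE /pospow x0.
have c : {for t, continuous (fun x : R => x `^ (s - 1))}.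
  apply/differentiable_continuous/derivable1_diffP/derivable_powR.
  by rewrite in_itv /= t0.
by apply: cvgM; [exact: c|exact: cvg_cst].
Qed.

(** For [1 < th] the function is a primitive; the recurrence [ml_ker_recl]
    brings every other exponent to this case. *)
Lemma continuous_ml_ker (R : realType) (mu rho th t : R) :
  0 < mu -> 0 < th -> 0 < t -> {for t, continuous (ml_ker mu rho th)}.
Proof.
move=> mu0 th0 t0.
have [n Hn] : exists n : nat, 1 < th + mu * n%:R.
  exists (Num.truncn mu^-1).+1; rewrite -[ltLHS]add0r; apply: ltrD => //.
  by rewrite -ltr_pdivrMl// mulr1 truncnS_gt.
elim: n th th0 Hn => [|n IH] th th0 Hn.
  move: Hn; rewrite mulr0 addr0 => th1.
  have th10 : 0 < th - 1 by rewrite subr_gt0.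
  have t1 : 0 < t + 1 by rewrite addr_gt0.
  have := parameterized_integral_continuous (ltW t1) (integrable_ml_ker_cc rho (t + 1) mu0 th10).
  move=> /(within_continuous_continuous t1) -/(_ t).
  rewrite in_itv /= t0 ltrDl ltr01 => /(_ isT).
  apply: continuous_eq_pos => // x x0.
  by rewrite /parameterized_integral -(ml_ker_int rho mu0 th10 x0) subrK.
have -> : ml_ker mu rho th = (fun x => rl_ker th x + rho * ml_ker mu rho (th + mu) x).
  by apply/funext => x; exact: ml_ker_recl.
apply: cvgD; first exact: continuous_rl_ker.
apply: cvgM; first exact: cvg_cst.
apply: IH; first exact: addr_gt0.
by rewrite -addrA -{1}[mu]mulr1 -mulrDr nat1r.
Qed.

Lemma derive1_ml_ker (R : realType) (mu rho th t : R) :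
  0 < mu -> 0 < th -> 0 < t ->
  derivable (ml_ker mu rho (th + 1)) t 1 /\
  derive1 (ml_ker mu rho (th + 1)) t = ml_ker mu rho th t.
Proof.
move=> mu0 th0 t0; have t1 : t < t + 1 by rewrite ltrDl.
have [dF eF] := continuous_FTC1_closed t1 (integrable_ml_ker_cc rho (t + 1) mu0 th0) t0
  (@continuous_ml_ker _ mu rho th t mu0 th0 t0).
have E (x : R) : 0 < x -> \int[lebesgue_measure]_(s in `[0, x]) ml_ker mu rho th s =
    ml_ker mu rho (th + 1) x by move=> x0; rewrite (ml_ker_int rho mu0 th0 x0).
split; first exact: (derivable_eq_pos t0 E dF).
by rewrite -eF -(derive1_eq_pos t0 E).
Qed.

Lemma rl_ker1 (R : realType) (t : R) : 0 < t -> rl_ker 1 t = 1.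
Proof. by move=> t0; rewrite !rl_kerE /pospow t0 subrr powRr0 Gamma1 divr1. Qed.

(** At [th = 1] the kernel is [1 + rho * ml_ker mu rho (mu + 1)] on the half
    line, and the constant disappears. *)
Lemma derive1_ml_ker1 (R : realType) (mu rho t : R) : 0 < mu -> 0 < t ->
  derivable (ml_ker mu rho 1) t 1 /\
  derive1 (ml_ker mu rho 1) t = rho * ml_ker mu rho mu t.
Proof.
move=> mu0 t0; have [dm em] := derive1_ml_ker rho mu0 mu0 t0.
have E (x : R) : 0 < x -> cst 1 x + rho *: ml_ker mu rho (mu + 1) x = ml_ker mu rho 1 x.
  by move=> x0; rewrite [RHS](@ml_ker_recl _ mu rho 1 x mu0 ltr01) (rl_ker1 x0) [mu + 1]addrC.
have dc : derivable (cst 1 : R -> R) t 1 by exact: derivable_cst.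
have dz : derivable (rho *: ml_ker mu rho (mu + 1)) t 1 by exact: derivableZ.
split; first exact: (derivable_eq_pos t0 E (derivableD dc dz)).
rewrite -(derive1_eq_pos t0 E) derive1E (deriveD dc dz) derive_cst add0r.
by rewrite (deriveZ _ dm) -derive1E em.
Qed.

(** * Linearity of fractional integrals and the Volterra equation *)

Lemma eq_RL_integral (R : realType) (s : R) (f g : R -> R) (t : R) : 0 < t ->
  (forall x : R, 0 < x -> f x = g x) -> RL_integral s f t = RL_integral s g t.
Proof.
move=> t0 fg; rewrite /RL_integral; case: ifP => _; first exact: fg.
congr (_ * _); apply: eq_Rintegral => u; rewrite inE /= in_itv /= => /andP[u0 _].
by rewrite /RL_kernel fg.
Qed.

Lemma eq_RL_integrable (R : realType) (s : R) (f g : R -> R) :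
  (forall x : R, 0 < x -> f x = g x) -> RL_integrable s f -> RL_integrable s g.
Proof.
move=> fg H s0 t t0; have := H s0 t t0; apply: eq_integrable => // u.
by rewrite inE /= in_itv /= => /andP[u0 _]; rewrite /RL_kernel fg.
Qed.

Lemma RL_kernel_linear (R : realType) (s c d : R) (f g : R -> R) (t u : R) :
  RL_kernel s (fun x => c * f x + d * g x) t u =
  c * RL_kernel s f t u + d * RL_kernel s g t u.
Proof. by rewrite /RL_kernel mulrDr mulrCA [X in _ + X]mulrCA. Qed.

Lemma RL_integrable_linear (R : realType) (s c d : R) (f g : R -> R) :
  RL_integrable s f -> RL_integrable s g ->
  RL_integrable s (fun x => c * f x + d * g x).
Proof.
move=> Hf Hg s0 t t0.
rewrite (_ : EFin \o _ = (fun u => c%:E * (EFin \o RL_kernel s f t) u) \+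
   (fun u => d%:E * (EFin \o RL_kernel s g t) u))%E; last first.
  by apply/funext => u /=; rewrite RL_kernel_linear.
by apply: integrableD => //; apply: integrableZl => //; [exact: Hf|exact: Hg].
Qed.

Lemma RL_integral_linear (R : realType) (s c d : R) (f g : R -> R) (t : R) :
  0 < t -> RL_integrable s f -> RL_integrable s g ->
  RL_integral s (fun x => c * f x + d * g x) t =
  c * RL_integral s f t + d * RL_integral s g t.
Proof.
move=> t0 Hf Hg; rewrite /RL_integral; case: ifPn => // s0.
have If := Hf s0 t t0; have Ig := Hg s0 t t0.
have -> : RL_kernel s (fun x => c * f x + d * g x) t =
    (fun u => c * RL_kernel s f t u + d * RL_kernel s g t u).
  by apply/funext => u; exact: RL_kernel_linear.
rewrite RintegralD//; last 2 first.
- exact: (integrableZl _ c If).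
- exact: (integrableZl _ d Ig).
by rewrite (RintegralZl c _ If)// (RintegralZl d _ Ig)// mulrDr mulrCA [X in _ + X]mulrCA.
Qed.

Lemma RL_integral0 (R : realType) (g : R -> R) : RL_integral 0 g = g.
Proof. by apply/funext => t; rewrite /RL_integral eqxx. Qed.

Lemma RL_integrable0 (R : realType) (g : R -> R) : RL_integrable 0 g.
Proof. by rewrite /RL_integrable eqxx. Qed.

Lemma RL_integrable_ml_ker (R : realType) (mu rho th s : R) :
  0 < mu -> 0 < th -> 0 <= s -> RL_integrable s (ml_ker mu rho th).
Proof.
move=> mu0 th0; rewrite le_eqVlt => /predU1P[<-|s0]; first exact: RL_integrable0.
apply/(RL_integrableP _ s0) => t t0.
exact: (RL_ml_ker rho t mu0 th0 s0).1.
Qed.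

Lemma RL_integral_ml_ker (R : realType) (mu rho th s t : R) :
  0 < mu -> 0 < th -> 0 <= s ->
  RL_integral s (ml_ker mu rho th) t = ml_ker mu rho (th + s) t.
Proof.
move=> mu0 th0; rewrite le_eqVlt => /predU1P[<-|s0].
  by rewrite RL_integral0 addr0.
exact: (RL_ml_ker rho t mu0 th0 s0).2.
Qed.

Lemma RL_integrable_add (R : realType) (s r : R) (g : R -> R) : 0 <= s -> 0 < r ->
  RL_integrable r g -> RL_integrable (s + r) g.
Proof.
move=> s0 r0 /(RL_integrableP _ r0) H.
have sr0 : 0 < s + r by rewrite ltr_wpDl.
apply/(RL_integrableP _ sr0) => t t0; apply: (integrable_rl_conv_add s0 r0 _ (H t t0)).
exact: measurable_RL_integrable H.
Qed.

Lemma RL_integrable_comp (R : realType) (s r : R) (g : R -> R) : 0 < s -> 0 < r ->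
  RL_integrable r g -> RL_integrable s (RL_integral r g).
Proof.
move=> s0 r0 /(RL_integrableP _ r0) H.
by apply/(RL_integrableP _ s0) => t t0; exact: (RL_semigroup s0 r0 t0 H).1.
Qed.

Lemma RL_integral_comp (R : realType) (s r : R) (g : R -> R) (t : R) :
  0 <= s -> 0 <= r -> 0 < t -> RL_integrable r g ->
  RL_integral s (RL_integral r g) t = RL_integral (s + r) g t.
Proof.
rewrite le_eqVlt => /predU1P[<-|s0]; first by rewrite RL_integral0 add0r.
rewrite le_eqVlt => /predU1P[<-|r0]; first by rewrite RL_integral0 addr0.
by move=> t0 /(RL_integrableP _ r0) H; exact: (RL_semigroup s0 r0 t0 H).2.
Qed.

(** Iterating gives [d = rho ^ n * I ^ (n mu) d], and the kernels of these
    integrals are the terms of a convergent Mittag-Leffler series. *)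
Lemma volterra_uniqueness (R : realType) (mu rho : R) (d : R -> R) : 0 < mu ->
  RL_integrable mu d -> (forall t : R, 0 < t -> d t = rho * RL_integral mu d t) ->
  forall t : R, 0 < t -> d t = 0.
Proof.
move=> mu0 id dE t t0.
have /(RL_integrableP _ mu0) Id := id.
have e0 n : 0 < mu * n%:R + mu by exact: mlter_exponent_gt0.
have e0' n : 0 <= mu * n%:R by rewrite mulr_ge0// ltW.
have in_ n : RL_integrable (mu * n%:R + mu) d by exact: RL_integrable_add.
have iter n : forall x : R, 0 < x -> d x = rho ^+ n.+1 * RL_integral (mu * n%:R + mu) d x.
  elim: n => [|n IH] x x0; first by rewrite mulr0 add0r expr1 (dE _ x0).
  rewrite (IH x x0).
  have -> : RL_integral (mu * n%:R + mu) d x =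
     RL_integral (mu * n%:R + mu) (fun y => rho * RL_integral mu d y + 0 * d y) x.
    by apply: eq_RL_integral => // y y0; rewrite mul0r addr0 dE.
  rewrite (RL_integral_linear _ _ x0 (RL_integrable_comp (e0 n) mu0 id) (in_ n)).
  rewrite mul0r addr0 (RL_integral_comp (ltW (e0 n)) (ltW mu0) x0 id) mulrA -exprSr.
  by rewrite (_ : mu * n%:R + mu + mu = mu * n.+1%:R + mu)// -natr1; ring.
pose L := \int[lebesgue_measure]_u `|rl_conv mu d t u|.
have L0 : 0 <= L by exact: Rintegral_ge0.
have bound n : `|d t| <= `|rho| * (t `^ (1 - mu) * Gamma mu * L) * ml_term mu `|rho| mu t n.
  rewrite (iter n t t0) normrM normrX exprS -!mulrA; apply: ler_wpM2l => //.
  have In := (RL_integrableP d (e0 n)).1 (in_ n) t t0.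
  rewrite (RL_integralE (e0 n) In) /ml_term !rl_kerE /pospow t0.
  have tE : t `^ (1 - mu) * t `^ (mu * n%:R + mu - 1) = `|t| `^ (mu * n%:R).
    rewrite -powRD; last by rewrite (gt_eqF t0) implybT.
    by rewrite gtr0_norm//; congr powR; ring.
  rewrite [leRHS](_ : _ = `|rho| ^+ n *
     (`|t| `^ (mu * n%:R) * (Gamma mu / Gamma (mu * n%:R + mu)) * L)); last first.
    by rewrite -tE; ring.
  apply: ler_wpM2l; first exact: exprn_ge0.
  apply: le_trans (le_normr_Rintegral _ In) _ => //.
  rewrite /L -RintegralZl//; last exact: integrable_norm (Id t t0).
  apply: le_Rintegral => //.
  - exact: integrable_norm.
  - apply: (integrableZl measurableT _ (integrable_norm (Id t t0))).
  - by move=> u _; apply: rl_conv_le.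
have lim0 : (fun n => `|rho| * (t `^ (1 - mu) * Gamma mu * L) *
    ml_term mu `|rho| mu t n) @ \oo --> (0 : R).
  rewrite -(mulr0 (`|rho| * (t `^ (1 - mu) * Gamma mu * L))).
  apply: cvgM; first exact: cvg_cst.
  by apply: cvg_series_cvg_0; exact: cvg_ml_term.
apply/eqP; rewrite -normr_le0; apply: (cvgr_to_ge lim0).
exact: nearW.
Qed.

(** * The Hilfer equation *)

(** The power kernels are the Mittag-Leffler kernels with [rho = 0]; in
    particular constants, being multiples of [rl_ker 1], are covered by the
    results on [ml_ker]. *)
Lemma rl_ker_ml_ker (R : realType) (th : R) : 0 < th -> rl_ker th = ml_ker 1 0 th.
Proof.
by move=> th0; apply/funext => x; rewrite (@ml_ker_recl _ 1 0 th x ltr01 th0) mul0r addr0.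
Qed.

Lemma RL_integrable_rl_ker (R : realType) (th s : R) : 0 < th -> 0 <= s ->
  RL_integrable s (rl_ker th).
Proof. by move=> th0 s0; rewrite rl_ker_ml_ker//; exact: RL_integrable_ml_ker. Qed.

Lemma RL_integral_rl_ker (R : realType) (th s t : R) : 0 < th -> 0 <= s ->
  RL_integral s (rl_ker th) t = rl_ker (th + s) t.
Proof.
move=> th0 s0; have ths : 0 < th + s by rewrite ltr_wpDr.
by rewrite (rl_ker_ml_ker th0) (rl_ker_ml_ker ths) RL_integral_ml_ker.
Qed.

Lemma RL_integral_ml_comb (R : realType) (mu rho th th' s c d t : R) :
  0 < mu -> 0 < th -> 0 < th' -> 0 <= s -> 0 < t ->
  RL_integral s (fun x => c * ml_ker mu rho th x + d * ml_ker mu rho th' x) t =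
  c * ml_ker mu rho (th + s) t + d * ml_ker mu rho (th' + s) t.
Proof.
move=> mu0 th0 th0' s0 t0.
rewrite (RL_integral_linear _ _ t0 (RL_integrable_ml_ker rho mu0 th0 s0)
  (RL_integrable_ml_ker rho mu0 th0' s0)).
by rewrite (RL_integral_ml_ker rho t mu0 th0 s0) (RL_integral_ml_ker rho t mu0 th0' s0).
Qed.

Lemma derive1_ml_comb (R : realType) (mu rho th c d t : R) :
  0 < mu -> 0 < th -> 0 < t ->
  let F := fun x => c * ml_ker mu rho 1 x + d * ml_ker mu rho (th + 1) x in
  derivable F t 1 /\
  derive1 F t = c * rho * ml_ker mu rho mu t + d * ml_ker mu rho th t.
Proof.
move=> mu0 th0 t0 F; have [d1 e1] := derive1_ml_ker1 rho mu0 t0.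
have [d2 e2] := derive1_ml_ker rho mu0 th0 t0.
have dz1 : derivable (c *: ml_ker mu rho 1) t 1 by exact: derivableZ.
have dz2 : derivable (d *: ml_ker mu rho (th + 1)) t 1 by exact: derivableZ.
have FE : F = c *: ml_ker mu rho 1 + d *: ml_ker mu rho (th + 1) by [].
split; first by rewrite FE; exact: derivableD.
rewrite FE derive1E (deriveD dz1 dz2) (deriveZ _ d1) (deriveZ _ d2).
by rewrite -!derive1E e1 e2 -mulrA.
Qed.

(** Each operation shifts the index of the kernels: [I^a] takes [1 - a] to [1],
    the derivative takes [1] to [mu] with a factor [rho], and [I^b] takes [mu]
    back to [mu + b = 1 - a]; the second summand goes from [mu + 1] to [1] and
    provides the constant [eta]. *)
Lemma hilfer_ml_ker (R : realType) (mu nu rho eta C : R) (p : R -> R) :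
  0 < mu -> mu <= 1 -> 0 <= nu -> nu <= 1 ->
  let a : R := (1 - nu) * (1 - mu) in
  (forall t : R, 0 < t ->
    p t = C * ml_ker mu rho (1 - a) t + eta * ml_ker mu rho (mu + 1) t) ->
  hilfer_derivable mu nu p /\
  forall t : R, 0 < t -> hilfer mu nu p t = rho * p t + eta.
Proof.
move=> mu0 mu1 nu0 nu1 a pE; set b := nu * (1 - mu).
have a0 : 0 <= a by rewrite mulr_ge0 ?subr_ge0.
have b0 : 0 <= b by rewrite mulr_ge0 ?subr_ge0.
have ab : a + b = 1 - mu by rewrite /a /b; ring.
have gam0 : 0 < 1 - a by lra.
have mua0 : 0 < mu + a by lra.
have mup0 : 0 < mu + 1 by lra.
pose q x := C * ml_ker mu rho (1 - a) x + eta * ml_ker mu rho (mu + 1) x.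
pose F x := C * ml_ker mu rho 1 x + eta * ml_ker mu rho (mu + a + 1) x.
have fE t : 0 < t -> F t = RL_integral a p t.
  move=> t0; rewrite (eq_RL_integral a t0 pE) RL_integral_ml_comb//.
  by rewrite subrK addrAC.
have f'E t : 0 < t -> C * rho * ml_ker mu rho mu t + eta * ml_ker mu rho (mu + a) t =
    derive1 (RL_integral a p) t.
  by move=> t0; rewrite -(derive1_eq_pos t0 fE) (derive1_ml_comb _ _ _ mu0 mua0 t0).2.
split.
  split.
  - apply: (@eq_RL_integrable _ a q); first by move=> x x0; rewrite pE.
    by apply: RL_integrable_linear; exact: RL_integrable_ml_ker.
  - move=> t t0; apply: (derivable_eq_pos t0 fE).
    exact: (derive1_ml_comb _ _ _ mu0 mua0 t0).1.
  - apply: (eq_RL_integrable f'E).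
    by apply: RL_integrable_linear; exact: RL_integrable_ml_ker.
move=> t t0; rewrite /hilfer -/a -/b -(eq_RL_integral b t0 f'E) RL_integral_ml_comb//.
have -> : mu + b = 1 - a by lra.
have -> : mu + a + b = 1 by lra.
rewrite (@ml_ker_recl _ mu rho 1 t mu0 ltr01) (rl_ker1 t0) [1 + mu]addrC (pE t t0); ring.
Qed.

(** The Lebesgue form of the fundamental theorem, for a derivative that need
    not be continuous. *)
Lemma primitive_RL_integral1 (R : realType) (f : R -> R) :
  (forall t : R, 0 < t -> derivable f t 1) -> RL_integrable 1 (derive1 f) ->
  exists c : R, forall t : R, 0 < t -> f t = c + RL_integral 1 (derive1 f) t.
Proof.
move=> df If.
have I0 (t : R) : 0 < t -> lebesgue_measure.-integrable `]0, t[ (EFin \o derive1 f).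
  by move=> t0; have := If (oner_neq0 _) t t0; rewrite RL_kernel1.
have key (x y : R) : 0 < x -> x <= y ->
    f y - f x = RL_integral 1 (derive1 f) y - RL_integral 1 (derive1 f) x.
  move=> x0 xy; have y0 : 0 < y by exact: lt_le_trans xy.
  have y1 : 0 < y + 1 by rewrite addr_gt0.
  have Iy : lebesgue_measure.-integrable `]0, y] (EFin \o derive1 f).
    apply: integrableS (I0 _ y1) => // u; rewrite /= !in_itv /= => /andP[-> uy].
    by rewrite (le_lt_trans uy)// ltrDl.
  have Ixy : lebesgue_measure.-integrable `[x, y] (EFin \o derive1 f).
    apply: integrableS Iy => // u; rewrite /= !in_itv /= => /andP[xu ->].
    by rewrite (lt_le_trans x0 xu).
  rewrite -(integral_derive1 xy _ Ixy); last first.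
    by move=> u /andP[xu _]; apply: df; exact: lt_le_trans xu.
  rewrite !RL_integral1 !Rintegral_itv_bndo_bndc; [|exact: I0|exact: I0].
  rewrite (Rintegral_itvB Iy) ?bnd_simp ?(ltW x0)//.
  rewrite Rintegral_itv_obnd_cbnd//; apply: integrableS Ixy => //.
  exact: subset_itv_oc_cc.
exists (f 1 - RL_integral 1 (derive1 f) 1); move=> t t0.
have [t1|/ltW t1] := leP 1 t.
  by rewrite -addrA [- _ + _]addrC -(key 1 t ltr01 t1) addrC subrK.
by rewrite -addrA [- _ + _]addrC -opprB -(key t 1 t0 t1) subKr.
Qed.

(** The case [mu = 1], where the equation is an ordinary one.  The integrating
    factor [expR (- rho * t)] shows that [p + eta / rho] is a multiple of an
    exponential, so that the derivative is bounded near [0]. *)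
Lemma RL_integrable1_ode (R : realType) (rho eta : R) (p : R -> R) : rho != 0 ->
  (forall t : R, 0 < t -> derivable p t 1) ->
  (forall t : R, 0 < t -> derive1 p t = rho * p t + eta) ->
  RL_integrable 1 (derive1 p).
Proof.
move=> rho0 dp ep.
pose E (t : R) := expR (- rho * t).
pose u := (p + cst (eta / rho)) * E.
have du (t : R) : 0 < t -> is_derive t (1 : R) u 0.
  move=> t0.
  have ip : is_derive t (1 : R) p (rho * p t + eta).
    by rewrite -(ep _ t0) derive1E; apply/derivableP; exact: dp.
  have iE : is_derive t (1 : R) E (- rho * E t).
    rewrite /E; apply: is_derive_eq.
    by rewrite /GRing.scale /=; ring.
  apply: is_derive_eq; rewrite /GRing.scale /= /cst !fctE /=.
  by field.
have uc (x y : R) : 0 < x -> x <= y -> u y = u x.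
  move=> x0 xy; apply/eqP; rewrite -subr_eq0; apply/eqP.
  have dxy (z : R) : x <= z -> is_derive z (1 : R) u 0.
    by move=> xz; apply: du; exact: lt_le_trans xz.
  have du0 (z : R) : z \in `]x, y[ -> is_derive z (1 : R) u ((fun=> 0) z).
    by rewrite in_itv /= => /andP[/ltW xz _]; exact: dxy.
  have cu : {within `[x, y], continuous u}.
    apply: derivable_within_continuous => z; rewrite in_itv /= => /andP[xz _].
    by case: (dxy z xz).
  by have [z _ ->] := MVT_segment xy du0 cu; rewrite mul0r.
have u1 (t : R) : 0 < t -> u t = u 1.
  by move=> t0; have [t1|/ltW t1] := leP t 1; [rewrite (uc t 1)|rewrite (uc 1 t)].
have pE (t : R) : 0 < t -> rho * u 1 * expR (rho * t) = derive1 p t.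
  move=> t0; rewrite -(u1 t t0) (ep t t0).
  have -> : u t = (p t + eta / rho) * E t by [].
  rewrite -!mulrA -expRD mulNr addNr expR0 mulr1; by field.
apply: (eq_RL_integrable pE) => _ t t0; rewrite RL_kernel1.
have : lebesgue_measure.-integrable `[0, t] (EFin \o (fun x => rho * u 1 * expR (rho * x))).
  apply: continuous_compact_integrable; first exact: segment_compact.
  apply: derivable_within_continuous => x _; exact: ex_derive.
by apply: integrableS => //; exact: subset_itv_oo_cc.
Qed.

(** [I^1 f' = I^(1 - b) (I^b f') = I^(mu + a) (rho * p + eta)], and
    [I^(mu + a) p = I^mu f].  That [f'] is integrable near [0] follows from its
    integrability at order [b < 1] if [0 < b], from [f' = rho * p + eta] and the
    integrability of [p] at order [a < 1] if [b = 0 < a], and from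
    [RL_integrable1_ode] if both vanish. *)
Lemma hilfer_volterra (R : realType) (mu nu rho eta : R) (p : R -> R) :
  0 < mu -> mu <= 1 -> 0 <= nu -> nu <= 1 -> rho != 0 ->
  let a : R := (1 - nu) * (1 - mu) in
  let f := RL_integral a p in
  hilfer_derivable mu nu p ->
  (forall t : R, 0 < t -> hilfer mu nu p t = rho * p t + eta) ->
  RL_integrable mu f /\
  exists c : R, forall t : R, 0 < t ->
    f t = c + rho * RL_integral mu f t + eta * rl_ker (mu + a + 1) t.
Proof.
move=> mu0 mu1 nu0 nu1 rho0 a f [ia df ib] pE.
pose b := nu * (1 - mu).
have a0 : 0 <= a by rewrite mulr_ge0 ?subr_ge0.
have b0 : 0 <= b by rewrite mulr_ge0 ?subr_ge0.
have ab : a + b = 1 - mu by rewrite /a /b; ring.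
have gam0 : 0 < 1 - a by lra.
have mua0 : 0 < mu + a by lra.
have bE : 1 - b = mu + a by lra.
have p1 : 0 < a -> RL_integrable 1 p.
  move=> apos; rewrite -(subrK a 1); apply: RL_integrable_add => //; exact: ltW.
have E (t : R) : 0 < t -> rho * p t + eta * rl_ker 1 t = RL_integral b (derive1 f) t.
  by move=> t0; rewrite (rl_ker1 t0) mulr1 -(pE t t0).
have k1 s : 0 <= s -> RL_integrable s (rl_ker (1 : R)).
  by move=> s0; exact: RL_integrable_rl_ker.
have f1 : RL_integrable 1 (derive1 f).
  have [bpos|] := ltP 0 b.
    by rewrite -(subrK b 1); apply: RL_integrable_add => //; lra.
  move=> b0'; have b00 : b = 0 by apply/eqP; rewrite eq_le b0' b0.
  have [apos|a0'] := ltP 0 a.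
    rewrite -[derive1 f]RL_integral0 -b00; apply: (eq_RL_integrable E).
    by apply: RL_integrable_linear; [exact: p1|exact: k1].
  have a00 : a = 0 by apply/eqP; rewrite eq_le a0' a0.
  have fp : f = p by rewrite /f a00 RL_integral0.
  apply: (RL_integrable1_ode (eta := eta) rho0) => t t0; first exact: df.
  have -> : derive1 f t = RL_integral b (derive1 f) t by rewrite b00 RL_integral0.
  by rewrite -(E t t0) (rl_ker1 t0) mulr1 fp.
have [c fE] : exists c : R, forall t : R, 0 < t -> f t = c + RL_integral 1 (derive1 f) t.
  exact: primitive_RL_integral1.
have fmu : RL_integrable mu f.
  apply: (@eq_RL_integrable _ mu (fun t => c * rl_ker 1 t + 1 * RL_integral 1 (derive1 f) t)).
    by move=> t t0; rewrite (fE t t0) (rl_ker1 t0) mulr1 mul1r.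
  apply: RL_integrable_linear; first by apply: k1; exact: ltW.
  exact: RL_integrable_comp.
have pmua : RL_integrable (mu + a) p.
  have [apos|a0'] := ltP 0 a; first by apply: RL_integrable_add => //; exact: ltW.
  have a00 : a = 0 by apply/eqP; rewrite eq_le a0' a0.
  by rewrite a00 addr0; move: fmu; rewrite /f a00 RL_integral0.
split => //; exists c => t t0; rewrite {1}(fE t t0) -addrA; congr (_ + _).
rewrite -{1}(subrK b 1) -(RL_integral_comp _ b0 t0 ib) ?bE ?(ltW mua0)//.
rewrite -(eq_RL_integral _ t0 E) (RL_integral_linear _ _ t0 pmua (k1 _ (ltW mua0))).
rewrite (RL_integral_comp (ltW mu0) a0 t0 ia) RL_integral_rl_ker ?(ltW mua0)//.
by rewrite [1 + _]addrC.
Qed.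

(** The constant [c] of the Volterra equation is the value of [C]: the
    primitive of order [a] of the explicit solution with [C = c] satisfies the
    same Volterra equation, and applying [I^b] to the derivative of the common
    [f] gives [rho * p + eta]. *)
Lemma hilfer_unique (R : realType) (mu nu rho eta : R) (p : R -> R) :
  0 < mu -> mu <= 1 -> 0 <= nu -> nu <= 1 -> rho != 0 ->
  let a : R := (1 - nu) * (1 - mu) in
  hilfer_derivable mu nu p ->
  (forall t : R, 0 < t -> hilfer mu nu p t = rho * p t + eta) ->
  exists C : R, forall t : R, 0 < t ->
    p t = C * ml_ker mu rho (1 - a) t + eta * ml_ker mu rho (mu + 1) t.
Proof.
move=> mu0 mu1 nu0 nu1 rho0 a hp pE.
have [fmu [c fE]] := hilfer_volterra mu0 mu1 nu0 nu1 rho0 hp pE.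
pose f := RL_integral a p.
have a0 : 0 <= a by rewrite mulr_ge0 ?subr_ge0.
have b0 : 0 <= nu * (1 - mu) by rewrite mulr_ge0 ?subr_ge0.
have gam0 : 0 < 1 - a.
  have : a + nu * (1 - mu) = 1 - mu by rewrite /a; ring.
  lra.
have mua0 : 0 < mu + a by lra.
have mua1 : 0 < mu + a + 1 by lra.
have mup1 : 0 < mu + 1 by lra.
pose q x := c * ml_ker mu rho (1 - a) x + eta * ml_ker mu rho (mu + 1) x.
have [hq qE] := @hilfer_ml_ker R mu nu rho eta c q mu0 mu1 nu0 nu1 (fun _ _ => erefl).
pose F := RL_integral a q.
have FE (t : R) : 0 < t -> F t = c * ml_ker mu rho 1 t + eta * ml_ker mu rho (mu + a + 1) t.
  move=> t0; rewrite /F RL_integral_ml_comb// subrK; congr (_ + _ * ml_ker _ _ _ _); ring.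
have Fmu : RL_integrable mu F.
  apply: (@eq_RL_integrable _ mu (fun x => c * ml_ker mu rho 1 x + eta * ml_ker mu rho (mu + a + 1) x)).
    by move=> t t0; rewrite FE.
  by apply: RL_integrable_linear; apply: RL_integrable_ml_ker => //; exact: ltW.
have FV (t : R) : 0 < t -> F t = c + rho * RL_integral mu F t + eta * rl_ker (mu + a + 1) t.
  move=> t0; rewrite (eq_RL_integral mu t0 FE) RL_integral_ml_comb ?(ltW mu0)//.
  rewrite (FE t t0) (@ml_ker_recl _ mu rho 1 t mu0 ltr01) (rl_ker1 t0).
  rewrite (@ml_ker_recl _ mu rho (mu + a + 1) t mu0 mua1); ring.
have fF (t : R) : 0 < t -> f t = F t.
  move=> t0; apply/eqP; rewrite -subr_eq0; apply/eqP.
  pose d x := 1 * f x + (- 1) * F x.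
  have dmu : RL_integrable mu d by exact: RL_integrable_linear.
  have <- : d t = f t - F t by rewrite /d mul1r mulN1r.
  apply: (volterra_uniqueness mu0 dmu _ t0) => {t t0} t t0.
  have lin (x y A B k : R) : x = c + rho * A + k -> y = c + rho * B + k ->
      1 * x + (- 1) * y = rho * (1 * A + (- 1) * B) by move=> -> ->; ring.
  rewrite (RL_integral_linear 1 (- 1) t0 fmu Fmu).
  exact: (lin _ _ _ _ _ (fE t t0) (FV t t0)).
exists c => t t0; apply: (mulfI rho0); apply: (addIr eta); rewrite -(pE t t0) -(qE t t0).
by apply: (eq_RL_integral _ t0) => x x0; exact: (derive1_eq_pos x0 fF).
Qed.

(** * The cobweb model *)

(** By [ml_ker_recl] at [th = 1], [E_mu (rho * t ^ mu) - 1] is [rho] times the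
    kernel of exponent [mu + 1]. *)
Lemma price_formulaE (R : realType) (mu th rho eta C t : R) :
  0 < mu -> 0 < th -> rho != 0 -> 0 < t ->
  C * t `^ (th - 1) * mittag_leffler mu th (rho * t `^ mu)
    - eta / rho + eta / rho * mittag_leffler mu 1 (rho * t `^ mu) =
  C * ml_ker mu rho th t + eta * ml_ker mu rho (mu + 1) t.
Proof.
move=> mu0 th0 rho0 t0; rewrite -mulrA -(ml_kerE rho mu0 th0 t0).
have := ml_kerE rho mu0 ltr01 t0.
rewrite subrr powRr0 mul1r => <-.
rewrite (@ml_ker_recl _ mu rho 1 t mu0 ltr01) (rl_ker1 t0) [1 + mu]addrC.
by field.
Qed.

Lemma cobweb_solutionE (R : realType) (alpha beta alpha1 beta1 delta mu nu : R)
    (p : R -> R) : beta1 != 0 -> delta != 0 ->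
  cobweb_solution alpha beta alpha1 beta1 delta mu nu p <->
  hilfer_derivable mu nu p /\
  forall t : R, 0 < t -> hilfer mu nu p t =
    (beta - beta1) / (delta * beta1) * p t + (alpha - alpha1) / (delta * beta1).
Proof.
move=> b1 d0; split => -[hp pE]; split => // t t0; have := pE t t0;
  rewrite /demand /supply; move: (hilfer mu nu p t) (p t) => h x.
- move=> e; have {e} e : beta1 * delta * h = alpha + beta * x - alpha1 - beta1 * x.
    by rewrite e; ring.
  apply: (mulfI (mulf_neq0 b1 d0)); rewrite e; field.
  by rewrite d0 b1.
- by move=> ->; field; rewrite d0 b1.
Qed.

Unset Implicit Arguments.

Theorem theorem3p3 (R : realType) (alpha beta alpha1 beta1 delta mu nu : R)
    (hbeta : beta != 0) (hbeta1 : beta1 != 0) (hdelta : delta != 0)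
    (hne : beta != beta1)
    (hmu0 : 0 < mu) (hmu1 : mu <= 1) (hnu0 : 0 <= nu) (hnu1 : nu <= 1)
    (p : R -> R) :
  let gam := mu + nu - mu * nu in
  let rho := (beta - beta1) / (delta * beta1) in
  let eta := (alpha - alpha1) / (delta * beta1) in
  cobweb_solution alpha beta alpha1 beta1 delta mu nu p <->
  exists C : R, forall t : R, 0 < t ->
    p t = C * t `^ (gam - 1) * mittag_leffler mu gam (rho * t `^ mu)
          - eta / rho + eta / rho * mittag_leffler mu 1 (rho * t `^ mu).
Proof.
move=> gam rho eta.
have rho0 : rho != 0.
  by rewrite mulf_neq0 ?subr_eq0// invr_eq0 mulf_neq0.
have gamE : gam = 1 - (1 - nu) * (1 - mu) by rewrite /gam; ring.
have gam0 : 0 < gam.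
  have : 0 <= nu * (1 - mu) by rewrite mulr_ge0// subr_ge0.
  have -> : nu * (1 - mu) = gam - mu by rewrite /gam; ring.
  lra.
apply: (iff_trans (cobweb_solutionE alpha beta alpha1 mu nu p hbeta1 hdelta)).
split.
- move=> [hp pE]; have [C HC] := hilfer_unique hmu0 hmu1 hnu0 hnu1 rho0 hp pE.
  by exists C => t t0; rewrite price_formulaE// gamE HC.
- move=> [C HC]; apply: (@hilfer_ml_ker _ mu nu rho eta C) => // t t0.
  by rewrite -gamE -price_formulaE// HC.
Qed.
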